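(* Let $p\ge0$, $q>0$ be integers, and let $\alpha_1,\dots,\alpha_p,\ \beta_1,\dots,\beta_q,\ a_1,\dots,a_p,\ b_1,\dots,b_q,\ T$ be positive real numbers such that $\kappa:=\sum_{s=1}^q\beta_s-\sum_{r=1}^p\alpha_r\in\mathbb{Z}_{>0}$. Define $C:=\prod_{r=1}^p\alpha_r^{\alpha_r}\prod_{s=1}^q\beta_s^{-\beta_s}$. Let $\{\omega_{k}\}_{k\ge0}$ be a sequence of positive real numbers such that $\frac{\omega_{k+1}}{\omega_k}=1+O(\frac1k)$ as $k\to\infty$, and set $$H(x):=\sum_{k=0}^\infty\omega_k\,\frac{\prod_{r=1}^p\Gamma(\alpha_rk+a_r)}{\prod_{s=1}^q\Gamma(\beta_sk+b_s)}\,(Tx)^{\kappa k}.$$ Then for any $\nu\in(0,\frac12)$, writing $H(x)=\sum_{n\ge0}H_nx^n$, the summands of $H(x)=\sum_{n\ge0}H_nx^n$ concentrate exponentially near $n\approx\kappa C^{1/\kappa}Tx$, with window term $(\kappa C^{1/\kappa}T)^{-\nu}x^{-\nu}$ and parameters $(\alpha,1-2\nu)$ for some $\alpha>0$.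
   Context: Exponential concentration: a power series $I(x)=\sum_{n\ge0}a_nx^n\in\mathbb{R}[[x]]$ is absolutely monotonic if it converges for all $x>0$ and all $a_n\ge0$. Let $I\ne0$ be absolutely monotonic, $f(x)$ a real polynomial with positive leading term, and $C',\nu,\alpha,\beta>0$. Set $n_\pm(x):=\lfloor f(x)(1\pm C'x^{-\nu})\rfloor$. The summands of $I(x)$ concentrate exponentially near $n\approx f(x)$ with window term $C'x^{-\nu}$ and parameters $(\alpha,\beta)$ if, as $x\to+\infty$, $\frac{1}{I(x)}\sum_{n=0}^{n_-(x)}a_nx^n=O(e^{-\alpha x^\beta})$ and $\frac{1}{I(x)}\sum_{n=n_+(x)}^{\infty}a_nx^n=O(e^{-\alpha x^\beta})$. Empty products equal 1. The assertion includes that $H$ is absolutely monotonic. *)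

(* Defs.v *)
From mathcomp Require Import all_boot all_order all_algebra.
From mathcomp Require Import all_classical all_reals all_analysis.
Set Implicit Arguments.
Unset Strict Implicit.
Unset Printing Implicit Defensive.
Import Order.TTheory GRing.Theory Num.Theory.
Import numFieldNormedType.Exports.
Local Open Scope classical_set_scope.
Local Open Scope ring_scope.

(* Lets the Landau notations f =O_ (+oo_R) g find the filter structure. *)
Canonical pinfty_filter_on (R : numFieldType) := FilterType (pinfty_nbhs R) _.

(* Euler's integral; only evaluated at x > 0, where it converges. *)
Definition Gamma (R : realType) (x : R) : R :=
  \int[lebesgue_measure]_(t in `]0, +oo[) (t `^ (x - 1) * expR (- t)).

(* A formal power series is given by its sequence of coefficients, and its
   partial sums at x are [pseries a x]. *)
Definition absolutely_monotonic (R : realType) (a : nat -> R) : Prop :=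
  (forall n, 0 <= a n) /\ (forall x : R, 0 < x -> cvgn (pseries a x)).

Definition pseries_sum (R : realType) (a : nat -> R) (x : R) : R :=
  limn (pseries a x).

Definition n_minus (R : realType) (f : {poly R}) (C' nu x : R) : int :=
  Num.floor (f.[x] * (1 - C' * x `^ (- nu))).

Definition n_plus (R : realType) (f : {poly R}) (C' nu x : R) : int :=
  Num.floor (f.[x] * (1 + C' * x `^ (- nu))).

(* The sums over 0 <= n <= m and over n >= max 0 m, for an integer m which may
   be negative; [absz (Num.max 0 (m + 1))] is the number of naturals n <= m. *)
Definition lower_sum (R : realType) (a : nat -> R) (m : int) (x : R) : R :=
  \sum_(0 <= n < absz (Num.max 0 (m + 1))) a n * x ^+ n.

Definition upper_sum (R : realType) (a : nat -> R) (m : int) (x : R) : R :=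
  limn (fun N => \sum_(absz (Num.max 0 m) <= n < N) a n * x ^+ n).

(* The summands of I(x) = sum_n a_n x^n concentrate exponentially near
   n ~ f(x) with window term C' x^(-nu) and parameters (al, be). The standing
   assumptions of the notion are part of the predicate. *)
Definition concentrates_exponentially (R : realType) (a : nat -> R)
    (f : {poly R}) (C' nu al be : R) : Prop :=
  [/\ absolutely_monotonic a /\ (exists n, a n <> 0),
      0 < lead_coef f,
      [/\ 0 < C', 0 < nu, 0 < al & 0 < be],
      (fun x : R => (pseries_sum a x)^-1 * lower_sum a (n_minus f C' nu x) x)
        =O_ (+oo_R) (fun x : R => expR (- al * x `^ be)) &
      (fun x : R => (pseries_sum a x)^-1 * upper_sum a (n_plus f C' nu x) x)
        =O_ (+oo_R) (fun x : R => expR (- al * x `^ be))].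

Definition gamma_weight (R : realType) (p q : nat) (alpha a : 'I_p -> R)
    (beta b : 'I_q -> R) (omega : nat -> R) (k : nat) : R :=
  omega k * ((\prod_(r < p) Gamma (alpha r * k%:R + a r))
             / \prod_(s < q) Gamma (beta s * k%:R + b s)).

Definition H_series (R : realType) (p q : nat) (alpha a : 'I_p -> R)
    (beta b : 'I_q -> R) (omega : nat -> R) (T : R) (kappa : nat) (x : R) :
    nat -> R :=
  [series gamma_weight alpha a beta b omega k * (T * x) ^+ (kappa * k)]_k.

(* The coefficient of x^n in H(x): for kappa > 0 it collects the at most one
   index k (necessarily k <= n) with kappa * k = n. *)
Definition H_coef (R : realType) (p q : nat) (alpha a : 'I_p -> R)
    (beta b : 'I_q -> R) (omega : nat -> R) (T : R) (kappa n : nat) : R :=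
  \sum_(0 <= k < n.+1 | (kappa * k == n)%N)
    gamma_weight alpha a beta b omega k * T ^+ (kappa * k).

(* Main.v *)
Require Import Defs.
From mathcomp Require Import all_boot all_order all_algebra.
From mathcomp Require Import all_classical all_reals all_analysis.
From mathcomp Require Import measurable_realfun.
From mathcomp Require Import ring lra zify.
Import Order.TTheory GRing.Theory Num.Theory.
Import numFieldNormedType.Exports.
Local Open Scope classical_set_scope.
Local Open Scope ring_scope.

Set Implicit Arguments.
Unset Strict Implicit.
Unset Printing Implicit Defensive.

(** Put [L = kappa * C^(1/kappa) * T] and [X = L x], and let [c k] be the
coefficient of [x^(kappa k)].

The quotient [c k.+1 / c k] is [(L / (kappa k))^kappa] up to a factor
[1 + O(1/k)]. Indeed [Gamma (y + z) / Gamma y = y^z (1 + O(1/y))], so each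
factor of the numerator contributes [(alpha_r k)^alpha_r] and each factor of
the denominator [(beta_s k)^(- beta_s)]; the powers of [k] add up to
[- kappa] and the constants to [C]. The asymptotics of the Gamma quotient needs
only the functional equation and Bernoulli's inequality [u^s <= 1 - s + s u]
integrated against Euler's density ([Gamma_le]).

An error [1 + O(1/k)] in the quotients costs a power of [k] in the
coefficients, and a power of [k] is absorbed by shifting a factorial: for a
suitable [B], [c k] lies between constant multiples of
[L^(kappa k) / (kappa (k + B))!] and [L^(kappa k) / (kappa (k - B))!]
([coef_sandwich]). Summing, [log H(x) = X + O(log x)].

This alone forces concentration ([concentration]). Replacing [x] by
[x e^(-d)] multiplies the [n]-th summand by [e^(- d n)], so the summands with
[d n <= E] add up to at most [e^E H(x e^(-d))], which relative to [H(x)] is at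
most a power of [x] times [exp (E - d X + 2 d^2 X)]. With [d = P/4] for the
lower tail and [d = - P/4] for the upper one, where [P = X^(- nu)], the
exponent is at most [1 - P^2 X / 8], that is [1 - X^(1 - 2 nu) / 8]. Half of
it absorbs the power of [x]. *)

(** * Euler's integral *)

(** Raise [c t / z <= exp (c t / z)] to the power [z]. *)
Lemma powR_le_expR (R : realType) (z c : R) : 0 <= z -> 0 < c ->
  exists2 K : R, 0 < K & forall t : R, 0 <= t -> t `^ z <= K * expR (c * t).
Proof.
move=> z0 c0; move: z0; rewrite le_eqVlt => /predU1P[<-|z0].
  exists 1 => // t t0; rewrite powRr0 mul1r -expR0 ler_expR.
  by rewrite mulr_ge0// ltW.
exists ((z / c) `^ z); first by rewrite powR_gt0// divr_gt0.
move=> t t0.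
have h : t <= z / c * expR (c * t / z).
  have := expR_ge1Dx (c * t / z) => h.
  have -> : t = z / c * (c * t / z) by field; rewrite !gt_eqF.
  rewrite ler_pM2l ?divr_gt0//.
  have -> : c * (z / c * (c * t / z)) / z = c * t / z by field; rewrite !gt_eqF.
  by apply: le_trans h; rewrite lerDr.
have -> : expR (c * t) = expR (c * t / z) `^ z.
  by rewrite -expRM divfK// gt_eqF.
rewrite -powRM ?expR_ge0 ?divr_ge0 ?(ltW z0) ?(ltW c0)//.
apply: (ge0_ler_powR (ltW z0)) => //; rewrite nnegrE.
by rewrite mulr_ge0 ?expR_ge0 ?divr_ge0 ?ltW.
Qed.

(** The fundamental theorem on a half-line gives a finite integral, and the
integrand is its own absolute value. *)
Lemma FTC2y_integrable (R : realType) (f F : R -> R) (a l : R) :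
  (forall x, a <= x -> 0 <= f x) ->
  {within `[a, +oo[, continuous f} ->
  F x @[x --> +oo] --> l ->
  (forall x, a < x -> derivable F x 1) -> F x @[x --> a^'+] --> F a ->
  {in `]a, +oo[, F^`()%classic =1 f} ->
  lebesgue_measure.-integrable `[a, +oo[ (EFin \o f).
Proof.
move=> f0 fc Fl Fd Fa FE; apply/integrableP; split.
  apply/measurable_EFinP; apply: subspace_continuous_measurable_fun => //.
under eq_integral.
  move=> x; rewrite inE/= in_itv/= andbT => ax.
  rewrite /= ger0_norm ?f0//; over.
by rewrite (ge0_continuous_FTC2y f0 fc Fl Fd Fa FE)/= ltry.
Qed.

Lemma cvg_expRNM (R : realType) (c : R) : 0 < c ->
  expR (- (c * x)) @[x --> +oo] --> (0 : R).
Proof.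
move=> c0.
apply: (@cvg_comp _ _ _ (fun x => c * x) (fun x => expR (- x)) _ (+oo_R)).
  exact: gt0_cvgMry.
exact: cvgr_expR.
Qed.

Lemma continuous_expRNM (R : realType) (c : R) :
  continuous (fun t : R => expR (- (c * t))).
Proof.
move=> x; apply: (@continuous_comp R R R (fun x => - (c * x)) expR).
  by apply: continuousN; exact: mulrl_continuous.
exact: continuous_expR.
Qed.

Lemma integral_expRNM (R : realType) (c a : R) : 0 < c ->
  lebesgue_measure.-integrable `[a, +oo[
    (EFin \o (fun t => expR (- (c * t)))) /\
  \int[lebesgue_measure]_(t in `[a, +oo[) expR (- (c * t)) =
    c^-1 * expR (- (c * a)).
Proof.
move=> c0.
pose F t : R := - (c^-1 * expR (- (c * t))).
have dF (x : R) : is_derive x 1 F (expR (- (c * x))).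
  apply: is_derive_eq; rewrite /GRing.scale/=.
  by field; rewrite gt_eqF.
have h1 : forall x, a <= x -> 0 <= expR (- (c * x)).
  by move=> *; rewrite expR_ge0.
have h2 : {within `[a, +oo[, continuous (fun x => expR (- (c * x)))}.
  by apply: continuous_subspaceT; exact: continuous_expRNM.
have h3 : F x @[x --> +oo] --> - (c^-1 * (0:R)).
  apply: cvgN; apply: cvgMl_tmp; exact: cvg_expRNM.
have h4 : forall x, a < x -> derivable F x 1 by move=> x _; exact: ex_derive.
have h5 : F x @[x --> a^'+] --> F a.
  apply: cvg_at_right_filter; apply: differentiable_continuous.
  by apply/derivable1_diffP; exact: ex_derive.
have h6 : {in `]a, +oo[, F^`()%classic =1 (fun x => expR (- (c * x)))}.
  by move=> x _; rewrite derive1E derive_val.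
split; first exact: (FTC2y_integrable h1 h2 h3 h4 h5 h6).
rewrite (Rintegral_ge0_continuous_FTC2y h1 h2 h3 h4 h5 h6) /F.
by ring.
Qed.

Lemma integrable_scale (R : realType) (D : set R) (c : R) (f : R -> R) :
  measurable D -> lebesgue_measure.-integrable D (EFin \o f) ->
  lebesgue_measure.-integrable D (EFin \o (fun t => c * f t)).
Proof.
move=> mD fi.
have -> : EFin \o (fun t => c * f t) = (fun t => c%:E * (EFin \o f) t)%E.
  by apply/funext => t; rewrite /= EFinM.
exact: integrableZl.
Qed.

Lemma integrable_add (R : realType) (D : set R) (f g : R -> R) :
  measurable D -> lebesgue_measure.-integrable D (EFin \o f) ->
  lebesgue_measure.-integrable D (EFin \o g) ->
  lebesgue_measure.-integrable D (EFin \o (fun t => f t + g t)).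
Proof.
move=> mD fi gi.
have -> : EFin \o (fun t => f t + g t) = ((EFin \o f) \+ (EFin \o g))%E.
  by apply/funext => t; rewrite /= EFinD.
exact: integrableD.
Qed.

(** For [y >= 1] the power is dominated by [exp (t / 2)], and the asymptotics
below concerns large arguments only. *)
Lemma Gamma_integrable (R : realType) (y : R) : 1 <= y ->
  lebesgue_measure.-integrable `]0, +oo[
    (EFin \o (fun t : R => t `^ (y - 1) * expR (- t))).
Proof.
move=> y1.
have hl : (0:R) < 2^-1 by lra.
have [K K0 hK] := @powR_le_expR R (y - 1) 2^-1 ltac:(lra) hl.
have [hi _] := integral_expRNM 0 hl.
have hi' : lebesgue_measure.-integrable `]0, +oo[
    (EFin \o (fun t : R => K * expR (- (2^-1 * t)))).
  apply: integrable_scale => //.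
  apply: integrableS hi => //.
  by apply: subset_itvr; rewrite bnd_simp.
apply: (le_integrable _ _ _ hi') => //.
- apply/measurable_EFinP; apply: measurable_funM.
    by apply: measurable_funTS; exact: measurable_powR.
  apply: measurableT_comp => //.
- move=> t /=; rewrite in_itv/= andbT => t0.
  rewrite lee_fin !ger0_norm ?mulr_ge0 ?powR_ge0 ?expR_ge0 ?(ltW K0)//.
  have -> : - t = - (2^-1 * t) - 2^-1 * t by lra.
  rewrite expRD mulrCA [K * _]mulrC ler_pM2l ?expR_gt0//.
  by rewrite expRN ler_pdivrMr ?expR_gt0// hK// ltW.
Qed.

Lemma Gamma_ge0 (R : realType) (y : R) : 0 <= Gamma y.
Proof.
by apply: Rintegral_ge0 => t _; rewrite mulr_ge0 ?powR_ge0 ?expR_ge0.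
Qed.

(** For [t >= 1] the integrand is at least [exp (- t)]. *)
Lemma Gamma_gt0 (R : realType) (y : R) : 1 <= y -> 0 < Gamma y.
Proof.
move=> y1.
have [hi he] := integral_expRNM 1 (@ltr01 R).
apply: (@lt_le_trans _ _
    (\int[lebesgue_measure]_(t in `[1, +oo[) expR (- (1 * t)))).
  by rewrite he invr1 mul1r expR_gt0.
have hs : [set` `[(1 : R), +oo[] `<=` `]0, +oo[.
  by apply: subset_itvr; rewrite bnd_simp.
rewrite /Gamma.
have hG := Gamma_integrable y1.
have hG1 : lebesgue_measure.-integrable `[1, +oo[
    (EFin \o (fun t : R => t `^ (y - 1) * expR (- t))).
  exact: integrableS hG.
apply: (@le_trans _ _
    (\int[lebesgue_measure]_(t in `[1, +oo[) (t `^ (y - 1) * expR (- t)))).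
  apply: le_Rintegral => // t /=; rewrite in_itv/= andbT => t1.
  rewrite mul1r ler_peMl ?expR_ge0//.
  rewrite -[leLHS](powRr0 t); apply: ler_powR => //; lra.
apply: fine_le.
- by apply: integrable_fin_num.
- by apply: integrable_fin_num.
- apply: ge0_subset_integral => //.
    by case/integrableP : hG.
  by move=> t _; rewrite lee_fin mulr_ge0 ?powR_ge0 ?expR_ge0.
Qed.

(** Integration by parts on the half-line amounts to [int g' = 0] for
[g t = t^y exp (- t)]. Since [g'] changes sign, a multiple of [exp (- t / 2)]
is added to [- g'] to make the integrand nonnegative, and its known integral
is subtracted afterwards. *)
Lemma GammaS (R : realType) (y : R) : 1 < y -> Gamma (y + 1) = y * Gamma y.
Proof.
move=> y1.
have hl : (0:R) < 2^-1 by lra.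
have [K K0 hK] := @powR_le_expR R (y - 1) 2^-1 ltac:(lra) hl.
have [K' K'0 hK'] := @powR_le_expR R y 2^-1 ltac:(lra) hl.
pose C : R := y * K.
pose e (t : R) := expR (- (2^-1 * t)).
pose g (t : R) := t `^ (y - 1) * expR (- t).
pose g1 (t : R) := t `^ y * expR (- t).
(* C is chosen so that C * e dominates the negative part y * g. *)
pose f (t : R) := C * e t + (g1 t - y * g t).
pose F (t : R) := - (2 * C * e t) - g1 t.
have ede (t : R) : expR (- t) = e t * e t.
  by rewrite /e -expRD; congr expR; lra.
have e2 (t : R) : expR (2^-1 * t) * e t = 1.
  by rewrite /e expRN divff// expR_eq0.
have e0 (t : R) : 0 < e t by exact: expR_gt0.
have ec : continuous e by exact: continuous_expRNM.
have enc : continuous (fun x : R => expR (- x)).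
  have := @continuous_expRNM R 1.
  by under eq_fun do rewrite mul1r.
have pc (z x : R) : 0 < x -> {for x, continuous (fun t => t `^ z)}.
  move=> x0; apply: differentiable_continuous.
  by apply/derivable1_diffP; apply: derivable_powR; rewrite in_itv/= x0.
have p0 (z : R) : 0 < z -> t `^ z @[t --> 0^'+] --> (0:R) `^ z.
  by move=> z0; rewrite powR0 ?gt_eqF//; exact: powR_cvg0.
have h1 : forall x, 0 <= x -> 0 <= f x.
  move=> t t0; rewrite /f.
  have : y * g t <= C * e t.
    rewrite /g ede /C -!mulrA ler_pM2l ?(lt_trans ltr01)// mulrA ler_pM2r//.
    by rewrite -[leRHS]mulr1 -[X in _ <= _ * X](e2 t) mulrA ler_pM2r// hK.
  have : 0 <= g1 t by rewrite mulr_ge0 ?powR_ge0 ?expR_ge0.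
  lra.
have gc x : 0 < x -> {for x, continuous g}.
  by move=> x0; apply: cvgM; [exact: pc|exact: enc].
have g1c x : 0 < x -> {for x, continuous g1}.
  by move=> x0; apply: cvgM; [exact: pc|exact: enc].
have g0 : g x @[x --> 0^'+] --> g 0.
  apply: cvgM; first by apply: p0; lra.
  by apply: cvg_at_right_filter; exact: enc.
have g10 : g1 x @[x --> 0^'+] --> g1 0.
  apply: cvgM; first by apply: p0; lra.
  by apply: cvg_at_right_filter; exact: enc.
have e00 : e x @[x --> 0^'+] --> e 0 by apply: cvg_at_right_filter; exact: ec.
have h2 : {within `[0, +oo[, continuous f}.
  apply/continuous_within_itvcyP; split.
    move=> x; rewrite in_itv/= andbT => x0.
    apply: cvgD; first by apply: cvgMl_tmp; exact: ec.
    apply: cvgB; first exact: g1c.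
    by apply: cvgMl_tmp; exact: gc.
  apply: cvgD; first by apply: cvgMl_tmp.
  by apply: cvgB => //; apply: cvgMl_tmp.
have h3 : F x @[x --> +oo] --> - (2 * C * (0:R)) - 0.
  have eoo : e x @[x --> +oo] --> (0:R) by exact: cvg_expRNM.
  apply: cvgB; first by apply: cvgN; exact: cvgMl_tmp.
  apply: (@squeeze_cvgr _ _ _ _ (fun=> 0) (fun t => K' * e t)).
  - near=> t.
    have t0 : 0 <= t by near: t; exact: nbhs_pinfty_ge.
    rewrite mulr_ge0 ?powR_ge0 ?expR_ge0//=.
    rewrite /g1 ede mulrA ler_pM2r//.
    by rewrite -[leRHS]mulr1 -[X in _ <= _ * X](e2 t) mulrA ler_pM2r// hK'.
  - exact: cvg_cst.
  - by rewrite -[X in _ --> X](mulr0 K'); apply: cvgMl_tmp.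
have dF (x : R) : 0 < x -> is_derive x 1 F (f x).
  move=> x0; rewrite /F /g1 /e.
  have ? := is_derive1_powR y x0.
  apply: is_derive_eq; rewrite /GRing.scale/=.
  by rewrite /f /g1 /g /e; field.
have h4 x : 0 < x -> derivable F x 1.
  by move=> xp; have ? := dF _ xp; exact: ex_derive.
have h5 : F x @[x --> 0^'+] --> F 0.
  by apply: cvgB => //; apply: cvgN; apply: cvgMl_tmp.
have h6 : {in `]0, +oo[, F^`()%classic =1 f}.
  move=> x; rewrite in_itv/= andbT => xp.
  by have ? := dF _ xp; rewrite derive1E derive_val.
have I1 : \int[lebesgue_measure]_(x in `]0, +oo[) f x = 2 * C.
  rewrite Rintegral_itv_obnd_cbnd.
    rewrite (Rintegral_ge0_continuous_FTC2y h1 h2 h3 h4 h5 h6) /F /e /g1.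
    by rewrite powR0 ?gt_eqF ?(lt_trans ltr01)// !mulr0 oppr0 expR0; lra.
  apply: integrableS (FTC2y_integrable h1 h2 h3 h4 h5 h6) => //.
  by apply: subset_itvr; rewrite bnd_simp.
have [ei ev] := integral_expRNM 0 hl.
have ei' : lebesgue_measure.-integrable `]0, +oo[ (EFin \o e).
  apply: integrableS ei => //.
  by apply: subset_itvr; rewrite bnd_simp.
have gi : lebesgue_measure.-integrable `]0, +oo[ (EFin \o g).
  by apply: Gamma_integrable; rewrite ltW.
have g1E : g1 = (fun t : R => t `^ (y + 1 - 1) * expR (- t)).
  by apply/funext => t; rewrite addrK.
have g1i : lebesgue_measure.-integrable `]0, +oo[ (EFin \o g1).
  by rewrite g1E; apply: Gamma_integrable; lra.
have ygi : lebesgue_measure.-integrable `]0, +oo[ (EFin \o (fun t => y * g t)).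
  exact: integrable_scale.
have Cei : lebesgue_measure.-integrable `]0, +oo[ (EFin \o (fun t => C * e t)).
  exact: integrable_scale.
have Bi : lebesgue_measure.-integrable `]0, +oo[
    (EFin \o (fun t => g1 t - y * g t)).
  have -> : (fun t => g1 t - y * g t) = (fun t => g1 t + - y * g t).
    by apply/funext => t; rewrite mulNr.
  by apply: integrable_add => //; exact: integrable_scale.
move: I1; rewrite /f RintegralD// RintegralB// !RintegralZl//.
rewrite {1}Rintegral_itv_obnd_cbnd// ev mulr0 oppr0 expR0.
have -> : Gamma (y + 1) = \int[lebesgue_measure]_(x in `]0, +oo[) g1 x.
  by rewrite /Gamma g1E.
rewrite /Gamma -/g; lra.
Unshelve. all: by end_near. Qed.

(** This is Young's inequality for the product [u^s * 1] with exponents [1/s]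
and [1/(1 - s)]. *)
Lemma bernoulli_powR (R : realType) (s u : R) : 0 <= s <= 1 -> 0 <= u ->
  u `^ s <= 1 - s + s * u.
Proof.
move=> /andP[s0 s1] u0.
move: s0; rewrite le_eqVlt => /predU1P[<-|s0]; first by rewrite powRr0; lra.
move: s1; rewrite le_eqVlt => /predU1P[->|s1]; first by rewrite powRr1//; lra.
have := @conjugate_powR R (u `^ s) 1 s^-1 (1 - s)^-1.
rewrite powR_ge0 ler01 !invr_gt0 s0 subr_gt0 s1 !invrK -powRrM divff ?gt_eqF//.
rewrite powRr1// powR1 mulr1 => /(_ isT isT isT isT).
lra.
Qed.

(** An instance of log-convexity: Bernoulli's inequality at [t / y],
integrated against [t^(y - 1) exp (- t)], where the functional equation makes
the linear part exact. *)
Lemma Gamma_le (R : realType) (y s : R) : 1 < y -> 0 <= s <= 1 ->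
  Gamma (y + s) <= y `^ s * Gamma y.
Proof.
move=> y1 s01.
have y0 : 0 < y by lra.
have -> : y `^ s * Gamma y =
    y `^ s * (1 - s) * Gamma y + y `^ s * (s / y) * Gamma (y + 1).
  by rewrite GammaS//; field; rewrite gt_eqF.
have gi (z : R) : 1 <= z -> lebesgue_measure.-integrable `]0, +oo[
    (EFin \o (fun t : R => t `^ (z - 1) * expR (- t))).
  exact: Gamma_integrable.
rewrite /Gamma -!RintegralZl//; last 2 first.
- by apply: gi; lra.
- by apply: gi; lra.
have zi (c z : R) : 1 <= z -> lebesgue_measure.-integrable `]0, +oo[
    (EFin \o (fun t : R => c * (t `^ (z - 1) * expR (- t)))).
  move=> z1.
  by apply: integrable_scale => //; exact: gi.
have i1 := zi (y `^ s * (1 - s)) y (ltW y1).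
have i2 := zi (y `^ s * (s / y)) (y + 1) ltac:(lra).
rewrite -RintegralD//; last first.
apply: le_Rintegral => //.
- by apply: gi; lra.
- exact: integrable_add.
move=> t /=; rewrite in_itv/= andbT => t0.
rewrite !mulrA -mulrDl ler_pM2r ?expR_gt0//.
have tn0 : t != 0 by rewrite gt_eqF.
have -> : t `^ (y + s - 1) = t `^ s * t `^ (y - 1).
  by rewrite -powRD ?tn0 ?implybT//; congr (_ `^ _); ring.
have -> : t `^ (y + 1 - 1) = t * t `^ (y - 1).
  rewrite -{2}(powRr1 (ltW t0)) -powRD ?tn0 ?implybT//; congr (_ `^ _); ring.
rewrite mulrA -mulrDl ler_pM2r ?powR_gt0//.
have -> : t `^ s = y `^ s * (t / y) `^ s.
  rewrite -powRM ?(ltW y0) ?divr_ge0 ?(ltW t0) ?(ltW y0)//.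
  by rewrite mulrC divfK// gt_eqF.
rewrite -!mulrA -mulrDr ler_pM2l ?powR_gt0//.
apply: le_trans (bernoulli_powR s01 (divr_ge0 (ltW t0) (ltW y0))) _.
by rewrite (mulrC t) mulrA.
Qed.

(** * Quotients of Gamma values *)

Definition one_plus_O_inv (R : realType) (u : nat -> R) : Prop :=
  exists2 M : R, 0 <= M & \forall k \near \oo, `|u k - 1| <= M / k%:R.

Lemma one_plus_O_inv_ext (R : realType) (u v : nat -> R) :
  (\forall k \near \oo, u k = v k) -> one_plus_O_inv u -> one_plus_O_inv v.
Proof.
move=> uv [M M0 hM]; exists M => //.
by near=> k; rewrite -(near uv k)//; near: k.
Unshelve. all: by end_near. Qed.

Lemma one_plus_O_inv1 (R : realType) : one_plus_O_inv (fun=> 1 : R).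
Proof.
by exists 0 => //; near=> k; rewrite subrr normr0 mul0r.
Unshelve. all: by end_near. Qed.

Lemma one_plus_O_invM (R : realType) (u v : nat -> R) :
  one_plus_O_inv u -> one_plus_O_inv v -> one_plus_O_inv (fun k => u k * v k).
Proof.
move=> [M M0 hM] [N N0 hN].
exists (M * N + M + N); first by rewrite !addr_ge0 ?mulr_ge0.
near=> k.
have k1 : (1 : R) <= k%:R by rewrite ler1n; near: k; exact: nbhs_infty_ge.
have -> : u k * v k - 1 = (u k - 1) * (v k - 1) + (u k - 1) + (v k - 1) by ring.
have hu : `|u k - 1| <= M / k%:R by near: k.
have hv : `|v k - 1| <= N / k%:R by near: k.
rewrite (le_trans (ler_normD _ _))// [leRHS]mulrDl lerD//.
rewrite (le_trans (ler_normD _ _))// [leRHS]mulrDl lerD// normrM.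
rewrite (le_trans (ler_pM _ _ hu hv))// mulrACA ler_wpM2l ?mulr_ge0//.
by rewrite ler_piMr ?invf_le1 ?invr_ge0// (lt_le_trans ltr01).
Unshelve. all: by end_near. Qed.

Lemma one_plus_O_invV (R : realType) (u : nat -> R) :
  one_plus_O_inv u -> one_plus_O_inv (fun k => (u k)^-1).
Proof.
move=> [M M0 hM]; exists (2 * M); first by rewrite mulr_ge0.
near=> k.
have k1 : (1 : R) <= k%:R by rewrite ler1n; near: k; exact: nbhs_infty_ge.
have k0 : (0 : R) < k%:R by exact: lt_le_trans k1.
have kM : 2 * M <= k%:R by near: k; exact: nbhs_infty_ger.
have hu : `|u k - 1| <= M / k%:R by near: k.
have hu2 : `|u k - 1| <= 2^-1.
  by apply: le_trans hu _; rewrite ler_pdivrMr//; lra.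
have u2 : 2^-1 <= u k by move: hu2; rewrite ler_norml => /andP[]; lra.
have u0 : 0 < u k by lra.
have -> : (u k)^-1 - 1 = (1 - u k) / u k by field; rewrite gt_eqF.
rewrite normrM distrC normfV (gtr0_norm u0) ler_pdivrMr//.
apply: le_trans hu _.
have : 0 <= M / k%:R by rewrite divr_ge0.
rewrite -mulrA; set z := M / _ => z0.
have : z * 2^-1 <= z * u k by rewrite ler_wpM2l.
lra.
Unshelve. all: by end_near. Qed.

Lemma one_plus_O_inv_squeeze (R : realType) (l u v : nat -> R) :
  one_plus_O_inv l -> one_plus_O_inv v ->
  (\forall k \near \oo, l k <= u k <= v k) -> one_plus_O_inv u.
Proof.
move=> [M M0 hM] [N N0 hN] h; exists (M + N); first by rewrite addr_ge0.
near=> k.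
have /andP[lu uv] : l k <= u k <= v k by near: k.
have : `|l k - 1| <= M / k%:R by near: k.
have : `|v k - 1| <= N / k%:R by near: k.
have : 0 <= M / k%:R by rewrite divr_ge0.
have : 0 <= N / k%:R by rewrite divr_ge0.
rewrite mulrDl !ler_norml => ? ? /andP[_ ?] /andP[? _]; apply/andP; lra.
Unshelve. all: by end_near. Qed.

Lemma one_plus_O_inv_prod (R : realType) (n : nat) (u : 'I_n -> nat -> R) :
  (forall i, one_plus_O_inv (u i)) ->
  one_plus_O_inv (fun k => \prod_(i < n) u i k).
Proof.
move=> h; elim: (index_enum _) => [|i s IH].
  by apply: one_plus_O_inv_ext (one_plus_O_inv1 R); near=> k; rewrite big_nil.
apply: one_plus_O_inv_ext (one_plus_O_invM (h i) IH).
by near=> k; rewrite big_cons.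
Unshelve. all: by end_near. Qed.

(** The base is at least 1, so the power lies between 1 and an integer
power. *)
Lemma one_plus_O_inv_powR (R : realType) (u : nat -> R) (z : R) :
  0 <= z -> (\forall k \near \oo, 1 <= u k) -> one_plus_O_inv u ->
  one_plus_O_inv (fun k => u k `^ z).
Proof.
move=> z0 u1 hu.
have [m zm] : exists m : nat, z <= m%:R.
  by exists (Num.trunc z).+1; rewrite ltW// truncnS_gt.
have hm : one_plus_O_inv (fun k => u k ^+ m).
  elim: m {zm} => [|m IH].
    by apply: one_plus_O_inv_ext (one_plus_O_inv1 R); near=> k; rewrite expr0.
  by apply: one_plus_O_inv_ext (one_plus_O_invM hu IH); near=> k; rewrite exprS.
apply: one_plus_O_inv_squeeze (one_plus_O_inv1 R) hm _; near=> k.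
have uk : 1 <= u k by near: k.
rewrite -[leLHS](powRr0 (u k)) -powR_mulrn ?(le_trans ler01)//.
by rewrite !ler_powR.
Unshelve. all: by end_near. Qed.

Lemma one_plus_O_inv_shift (R : realType) (y : nat -> R) (c z : R) :
  0 < c -> 0 <= z -> (\forall k \near \oo, c * k%:R <= y k) ->
  one_plus_O_inv (fun k => (y k + z) / y k).
Proof.
move=> c0 z0 yc; exists (z / c); first by rewrite divr_ge0// ltW.
near=> k.
have k0 : (0 : R) < k%:R by rewrite ltr0n; near: k; exact: nbhs_infty_gt.
have yk : c * k%:R <= y k by near: k.
have y0 : 0 < y k by apply: lt_le_trans yk; rewrite mulr_gt0.
have -> : (y k + z) / y k - 1 = z / y k by field; rewrite gt_eqF.
rewrite ger0_norm ?divr_ge0 ?(ltW y0)// -mulrA ler_wpM2l//.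
by rewrite -invfM lef_pV2 ?posrE ?mulr_gt0.
Unshelve. all: by end_near. Qed.

(** The lower bound is the upper bound of [Gamma_le] at [y + s] with the
complementary step [1 - s], which leads to [Gamma (y + 1) = y Gamma y]. *)
Lemma Gamma_ratio_bounds (R : realType) (y s : R) : 1 < y -> 0 <= s <= 1 ->
  ((y + 1) / y)^-1 <= Gamma (y + s) / (Gamma y * y `^ s) <= 1.
Proof.
move=> y1 /andP[s0 s1].
have y0 : 0 < y by lra.
have G0 : 0 < Gamma y by apply: Gamma_gt0; lra.
have p0 : 0 < y `^ s by rewrite powR_gt0.
apply/andP; split; last first.
  by rewrite ler_pdivrMr ?mulr_gt0// mul1r mulrC Gamma_le// s0 s1.
have := @Gamma_le R (y + s) (1 - s) ltac:(lra) ltac:(apply/andP; lra).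
have -> : y + s + (1 - s) = y + 1 by ring.
rewrite GammaS// => h.
rewrite invf_div ler_pdivlMr ?mulr_gt0// mulrAC ler_pdivrMr; last by lra.
have -> : y * (Gamma y * y `^ s) = y `^ s * (y * Gamma y) by ring.
apply: (@le_trans _ _ (y `^ s * ((y + s) `^ (1 - s) * Gamma (y + s)))).
  by rewrite ler_pM2l.
rewrite mulrA [leRHS]mulrC ler_wpM2r ?Gamma_ge0//.
have ys : y + s != 0 by rewrite gt_eqF//; lra.
apply: (@le_trans _ _ ((y + s) `^ s * (y + s) `^ (1 - s))).
  rewrite ler_wpM2r ?powR_ge0//.
  by apply: (ge0_ler_powR s0); rewrite ?nnegrE; lra.
rewrite -powRD ?ys ?implybT// subrKC powRr1; lra.
Qed.

(** For steps [z <= 1] this is [Gamma_ratio_bounds]; a unit step multiplies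
the quotient by [(y + z - 1) / y = 1 + O(1/k)]. *)
Lemma Gamma_ratio_asymp (R : realType) (z : R) (y : nat -> R) (c : R) :
  0 <= z -> 0 < c -> (\forall k \near \oo, c * k%:R <= y k) ->
  one_plus_O_inv (fun k => Gamma (y k + z) / (Gamma (y k) * y k `^ z)).
Proof.
move=> z0 c0 yc.
have y1 : \forall k \near \oo, 1 < y k.
  near=> k.
  have yk : c * k%:R <= y k by near: k.
  apply: lt_le_trans yk; rewrite -ltr_pdivrMl// mulr1.
  by near: k; exact: nbhs_infty_gtr.
have [n nz zn] : exists2 n : nat, n%:R <= z & z < n.+1%:R.
  by exists (Num.trunc z); rewrite ?truncn_le ?truncnS_gt.
elim: n z z0 nz zn => [|n IH] z z0 nz zn.
  apply: one_plus_O_inv_squeeze (one_plus_O_inv1 R) _.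
    exact: one_plus_O_invV (one_plus_O_inv_shift c0 (@ler01 R) yc).
  near=> k; apply: Gamma_ratio_bounds; first by near: k.
  by rewrite z0 ltW.
have z1 : 0 <= z - 1 by move: nz; rewrite -natr1; have := ler0n R n; lra.
have := IH (z - 1) z1 ltac:(move: nz; rewrite -natr1; lra)
  ltac:(move: zn; rewrite -[n.+2%:R]natr1; lra).
move=> /(one_plus_O_invM (one_plus_O_inv_shift c0 z1 yc)).
apply: one_plus_O_inv_ext; near=> k.
have yk : 1 < y k by near: k.
have y0 : 0 < y k by lra.
have -> : y k + z = y k + (z - 1) + 1 by ring.
have -> : y k `^ z = y k * y k `^ (z - 1).
  rewrite -[X in X * _](powRr1 (ltW y0)) -powRD ?(gt_eqF y0) ?implybT//.
  by congr (_ `^ _); ring.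
rewrite GammaS; last by lra.
have Gy : Gamma (y k) != 0 by rewrite gt_eqF// Gamma_gt0// ltW.
have py : y k `^ (z - 1) != 0 by rewrite gt_eqF// powR_gt0.
by field; rewrite Gy py gt_eqF.
Unshelve. all: by end_near. Qed.

(** The base [al * k + a] of the power is replaced by [al * k] at the price of
one more factor [(1 + O(1/k))^al]. *)
Lemma Gamma_step_asymp (R : realType) (al a : R) : 0 < al -> 0 < a ->
  one_plus_O_inv (fun k => Gamma (al * k.+1%:R + a) / Gamma (al * k%:R + a)
                           / (al * k%:R) `^ al).
Proof.
move=> al0 a0.
pose y (k : nat) := al * k%:R + a.
have yc : \forall k \near \oo, al * k%:R <= y k by near=> k; rewrite /y; lra.
have H := Gamma_ratio_asymp (ltW al0) al0 yc.
have yk' : \forall k \near \oo, al * k%:R <= al * k%:R by near=> k.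
have H2 := one_plus_O_inv_shift al0 (ltW a0) yk'.
have H3 : \forall k \near \oo, 1 <= (al * k%:R + a) / (al * k%:R).
  near=> k.
  have k0 : (0 : R) < k%:R by rewrite ltr0n; near: k; exact: nbhs_infty_gt.
  by rewrite ler_pdivlMr ?mulr_gt0// mul1r lerDl ltW.
have H4 := one_plus_O_invM H (one_plus_O_inv_powR (ltW al0) H3 H2).
apply: one_plus_O_inv_ext H4; near=> k.
have k0 : (0 : R) < k%:R by rewrite ltr0n; near: k; exact: nbhs_infty_gt.
have ak0 : 0 < al * k%:R by rewrite mulr_gt0.
have y0 : 0 < y k by rewrite /y addr_gt0.
rewrite -/(y k) powRM ?invr_ge0 ?(ltW y0) ?(ltW ak0)//.
rewrite -[(al * k%:R)^-1]powR_inv1 ?(ltW ak0)// -powRrM mulN1r powRN.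
have -> : al * k.+1%:R + a = y k + al by rewrite /y -natr1; ring.
have py : y k `^ al != 0 by rewrite gt_eqF// powR_gt0.
rewrite invfM mulrA -!mulrA; congr (_ * _); congr (_ * _).
by rewrite mulrA mulVf// mul1r.
Unshelve. all: by end_near. Qed.

(** * Factorial bounds for the coefficients *)

Lemma fact_add_le (m n : nat) : ((m + n)`! <= m`! * (m + n) ^ n)%N.
Proof.
elim: n => [|n IH]; first by rewrite addn0 expn0 muln1.
rewrite addnS factS expnS mulnCA leq_mul2l /=.
apply: leq_trans IH _; rewrite leq_mul2l; apply/orP; right.
by case: n => [|n]; rewrite ?expn0// leq_exp2r// leqnSn.
Qed.

Lemma fact_add_ge (m n : nat) : (m`! * m ^ n <= (m + n)`!)%N.
Proof.
elim: n => [|n IH]; first by rewrite addn0 expn0 muln1.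
rewrite addnS factS expnSr mulnA mulnC leq_mul//.
by rewrite (leq_trans (leq_addr n m)).
Qed.

Lemma eventually_ge (P : nat -> Prop) :
  (\forall k \near \oo, P k) -> exists K, forall k, (K <= k)%N -> P k.
Proof. by case=> K _ hK; exists K => k Kk; apply: hK. Qed.

Section ratio_sandwich.
Context (R : realType) (u : nat -> R) (kappa : nat) (M : R).
Hypothesis kappa_gt0 : (0 < kappa)%N.
Hypothesis M_ge0 : 0 <= M.
Hypothesis u_gt0 : \forall k \near \oo, 0 < u k.
Hypothesis u_ratio : \forall k \near \oo,
  `|u k.+1 / u k * (kappa%:R * k%:R) ^+ kappa - 1| <= M / k%:R.

(** With [B - 1 >= M], the sequence [u k * (kappa (k - B))!] is eventually
nonincreasing: the factorial grows by at most [(kappa (k + 1 - B))^kappa], and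
[(1 + M/k) (1 - (B - 1)/k) <= 1]. *)
Lemma ratio_upper : exists (A : R) (B K : nat), 0 < A /\
  forall k, (K <= k)%N -> u k <= A / (kappa * (k - B))`!%:R.
Proof.
pose B := (Num.trunc M).+2.
have BM : M <= B%:R - 1.
  by rewrite /B -natr1 addrK ltW// truncnS_gt.
have [K hK] : exists K, forall k, (K <= k)%N ->
    0 < u k /\ (B <= k)%N /\
    u k.+1 * (kappa * (k.+1 - B))`!%:R <= u k * (kappa * (k - B))`!%:R.
  apply: eventually_ge; near=> k.
  have uk : 0 < u k by near: k.
  have Bk : (B <= k)%N by near: k; exact: nbhs_infty_ge.
  split=> //; split=> //.
  have k0 : (0 : R) < k%:R by rewrite ltr0n (leq_trans _ Bk).
  have kk0 : 0 < (kappa%:R * k%:R : R) ^+ kappa.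
    by rewrite exprn_gt0// mulr_gt0// ltr0n.
  have : `|u k.+1 / u k * (kappa%:R * k%:R) ^+ kappa - 1| <= M / k%:R.
    by near: k.
  rewrite ler_norml => /andP[_ hr].
  have {}hr : u k.+1 <= u k * ((1 + M / k%:R) / (kappa%:R * k%:R) ^+ kappa).
    rewrite mulrC -ler_pdivrMr// ler_pdivlMr//; lra.
  have hf : (kappa * (k.+1 - B))`!%:R <=
      (kappa * (k - B))`!%:R * (kappa%:R * (k.+1%:R - B%:R)) ^+ kappa :> R.
    rewrite -natrB ?(leqW Bk)// -natrM -natrX -natrM ler_nat.
    by rewrite subSn// mulnS addnC fact_add_le.
  apply: le_trans (ler_wpM2r _ hr) _; first by rewrite ler0n.
  rewrite -mulrA ler_pM2l//.
  have c0 : 0 <= (1 + M / k%:R) / (kappa%:R * k%:R) ^+ kappa.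
    by rewrite divr_ge0 ?(ltW kk0)// addr_ge0// divr_ge0// ltW.
  apply: le_trans (ler_wpM2l c0 hf) _.
  rewrite mulrCA ger_pMr ?ltr0n ?fact_gt0//.
  rewrite -mulrA mulrC -ler_pdivlMr ?(lt_le_trans ltr01)//; last first.
    by rewrite lerDl divr_ge0// ltW.
  rewrite mulrC -expr_div_n -mulf_div divff ?pnatr_eq0 -?lt0n// mul1r.
  set z : R := (k.+1%:R - B%:R) / k%:R.
  have z0 : 0 <= z by rewrite divr_ge0 ?ler0n// subr_ge0 ler_nat leqW.
  have zM : z <= 1 - M / k%:R.
    rewrite /z -natr1 ler_pdivrMr// mulrBl mul1r divfK ?gt_eqF//; lra.
  have Mk : 0 <= M / k%:R by rewrite divr_ge0// ltW.
  apply: (@le_trans _ _ z).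
    rewrite -[leRHS]expr1; apply: ler_wiXn2l => //; lra.
  rewrite div1r; apply: le_trans zM _.
  rewrite -[leRHS]mul1r ler_pdivlMr; nra.
exists (u K * (kappa * (K - B))`!%:R), B, K; split.
  by rewrite mulr_gt0 ?ltr0n ?fact_gt0// (hK K (leqnn _)).1.
move=> k Kk; rewrite ler_pdivlMr ?ltr0n ?fact_gt0//.
elim: k Kk => [|k IH]; first by rewrite leqn0 => /eqP ->.
rewrite leq_eqVlt => /predU1P[->//|]; rewrite ltnS => Kk.
by apply: le_trans (IH Kk); case: (hK k Kk) => _ [].
Unshelve. all: by end_near. Qed.

(** With [B >= 2 M], the sequence [u k * (kappa (k + B))!] is eventually
nondecreasing, because [(1 - M/k) (1 + B/k) >= 1] as soon as [k >= 2 M]. *)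
Lemma ratio_lower : exists (A : R) (B K : nat), 0 < A /\
  forall k, (K <= k)%N -> A / (kappa * (k + B))`!%:R <= u k.
Proof.
pose B := (Num.trunc (2 * M)).+1.
have BM : 2 * M <= B%:R by rewrite ltW// truncnS_gt.
have [K hK] : exists K, forall k, (K <= k)%N ->
    0 < u k /\
    u k * (kappa * (k + B))`!%:R <= u k.+1 * (kappa * (k.+1 + B))`!%:R.
  apply: eventually_ge; near=> k.
  have uk : 0 < u k by near: k.
  split=> //.
  have k0 : (0 : R) < k%:R by rewrite ltr0n; near: k; exact: nbhs_infty_gt.
  have k2M : 2 * M <= k%:R by near: k; exact: nbhs_infty_ger.
  have kk0 : 0 < (kappa%:R * k%:R : R) ^+ kappa.
    by rewrite exprn_gt0// mulr_gt0// ltr0n.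
  have : `|u k.+1 / u k * (kappa%:R * k%:R) ^+ kappa - 1| <= M / k%:R.
    by near: k.
  rewrite ler_norml => /andP[hr _].
  have {}hr : u k * ((1 - M / k%:R) / (kappa%:R * k%:R) ^+ kappa) <= u k.+1.
    rewrite mulrC -ler_pdivlMr// ler_pdivrMr//; lra.
  have hf : (kappa * (k + B))`!%:R * (kappa%:R * (k%:R + B%:R)) ^+ kappa <=
      (kappa * (k.+1 + B))`!%:R :> R.
    rewrite -natrD -natrM -natrX -natrM ler_nat.
    by rewrite addSn mulnS [(kappa + _)%N]addnC fact_add_ge.
  apply: le_trans (ler_wpM2r _ hr); last by rewrite ler0n.
  rewrite -mulrA ler_pM2l//.
  have Mk : M / k%:R <= 2^-1 by rewrite ler_pdivrMr//; lra.
  have Mk0 : 0 <= M / k%:R by rewrite divr_ge0// ltW.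
  have c0 : 0 <= (1 - M / k%:R) / (kappa%:R * k%:R) ^+ kappa.
    by rewrite divr_ge0 ?(ltW kk0)//; lra.
  apply: le_trans (ler_wpM2l c0 hf).
  rewrite mulrCA ler_peMr ?ler0n//.
  rewrite -mulrA mulrC [X in X * _]mulrC -expr_div_n -mulf_div.
  rewrite divff ?pnatr_eq0 -?lt0n// mul1r.
  have -> : (k%:R + B%:R) / k%:R = 1 + B%:R / k%:R :> R.
    by field; rewrite gt_eqF.
  have BMk : 2 * (M / k%:R) <= B%:R / k%:R by rewrite mulrA ler_pM2r ?invr_gt0.
  set z := M / k%:R in Mk Mk0 BMk *; set w := B%:R / k%:R in BMk *.
  have : 1 + w <= (1 + w) ^+ kappa.
    rewrite -[leLHS]expr1; apply: ler_weXn2l => //; lra.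
  set W := (1 + w) ^+ kappa => hW; nra.
exists (u K * (kappa * (K + B))`!%:R), B, K; split.
  by rewrite mulr_gt0 ?ltr0n ?fact_gt0// (hK K (leqnn _)).1.
move=> k Kk; rewrite ler_pdivrMr ?ltr0n ?fact_gt0//.
elim: k Kk => [|k IH]; first by rewrite leqn0 => /eqP ->.
rewrite leq_eqVlt => /predU1P[->//|]; rewrite ltnS => Kk.
by apply: le_trans (IH Kk) _; case: (hK k Kk).
Unshelve. all: by end_near. Qed.

End ratio_sandwich.

(** * Power series with factorial coefficients *)

Lemma expR_partial_le (R : realType) (X : R) (N : nat) : 0 <= X ->
  \sum_(0 <= n < N) X ^+ n / n`!%:R <= expR X.
Proof.
move=> X0; apply: (@nondecreasing_cvgn_le R (series (exp_coeff X))).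
  apply: nondecreasing_series => n _ _.
  by rewrite /exp_coeff/= divr_ge0 ?exprn_ge0.
exact: is_cvg_series_exp_coeff.
Qed.

Lemma expR_le_partial (R : realType) (X b : R) :
  (forall N, \sum_(0 <= n < N) X ^+ n / n`!%:R <= b) -> expR X <= b.
Proof.
move=> h; apply: limr_le; first exact: is_cvg_series_exp_coeff.
by near=> N; exact: h.
Unshelve. all: by end_near. Qed.

Lemma absolutely_monotonic_partial_le (R : realType) (h : nat -> R) (x : R)
    (N : nat) :
  absolutely_monotonic h -> 0 < x ->
  \sum_(0 <= n < N) h n * x ^+ n <= pseries_sum h x.
Proof.
move=> [h0 hc] x0.
apply: (@nondecreasing_cvgn_le R (pseries h x)); last exact: hc.
by apply: nondecreasing_series => n _ _; rewrite mulr_ge0// exprn_ge0// ltW.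
Qed.

(** The terms of index at least [D] form [X^D] times an exponential series;
each of the [D] others is at most [X^D]. *)
Lemma shifted_factorial_partial_le (R : realType) (D N : nat) (X : R) :
  1 <= X ->
  \sum_(0 <= n < N) X ^+ n / (n - D)`!%:R <= D.+1%:R * (X ^+ D * expR X).
Proof.
move=> X1.
have X0 : 0 <= X by exact: le_trans X1.
have t0 n : 0 <= X ^+ n / (n - D)`!%:R by rewrite divr_ge0 ?exprn_ge0.
apply: (@le_trans _ _ (\sum_(0 <= n < D + N) X ^+ n / (n - D)`!%:R)).
  by rewrite (big_cat_nat _ (leq_addl D N))//= lerDl sumr_ge0.
rewrite (big_cat_nat _ (leq_addr N D))//= -natr1 mulrDl mul1r lerD//.
  rewrite mulr_natl -[X in _ *+ X]subn0 -sumr_const_nat.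
  rewrite !big_nat; apply: ler_sum => n /andP[_ nD].
  rewrite (_ : (n - D)%N = 0%N) ?fact0 ?divr1; last first.
    by apply/eqP; rewrite subn_eq0 ltnW.
  apply: (@le_trans _ _ (X ^+ D)).
    by apply: ler_weXn2l => //; exact: ltnW.
  by rewrite ler_peMr ?exprn_ge0// -expR0 ler_expR.
rewrite -{1}[D]add0n big_addn addKn.
apply: le_trans (ler_wpM2l (exprn_ge0 D X0) (expR_partial_le N X0)).
by rewrite mulr_sumr; apply: ler_sum => n _; rewrite addnK exprD mulrCA mulrA.
Qed.

Lemma pseries_partial_upper (R : realType) (h : nat -> R) (A L : R)
    (D N : nat) (X : R) :
  0 <= A -> 0 < L -> (forall n, h n <= A * L ^+ n / (n - D)`!%:R) -> 1 <= X ->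
  \sum_(0 <= n < N) h n * (X / L) ^+ n <= A * D.+1%:R * X ^+ D * expR X.
Proof.
move=> A0 L0 hU X1.
have X0 : 0 <= X by exact: le_trans X1.
rewrite -!mulrA.
apply: le_trans (ler_wpM2l A0 (shifted_factorial_partial_le D N X1)).
rewrite mulr_sumr; apply: ler_sum => n _.
apply: le_trans (ler_wpM2r _ (hU n)) _.
  by rewrite exprn_ge0// divr_ge0// ltW.
rewrite expr_div_n le_eqVlt; apply/orP; left; apply/eqP.
field; rewrite pnatr_eq0 -lt0n fact_gt0/=.
by rewrite expf_neq0// gt_eqF.
Qed.

Lemma cvgn_pseries_factorial (R : realType) (h : nat -> R) (A L : R)
    (D : nat) (x : R) :
  0 <= A -> 0 < L -> (forall n, 0 <= h n) ->
  (forall n, h n <= A * L ^+ n / (n - D)`!%:R) -> cvgn (pseries h x).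
Proof.
move=> A0 L0 h0 hU; apply: normed_cvg; apply: nondecreasing_is_cvgn.
  by apply: nondecreasing_series => n _ _; exact: normr_ge0.
pose X := Num.max 1 (L * `|x|).
exists (A * D.+1%:R * X ^+ D * expR X) => _ [N _ <-].
have X1 : 1 <= X by rewrite le_max lexx.
apply: le_trans (pseries_partial_upper N A0 L0 hU X1).
apply: ler_sum => n _; rewrite /= normrM normrX (ger0_norm (h0 n)) ler_wpM2l//.
apply: lerXn2r; rewrite ?nnegrE// ?divr_ge0 ?(le_trans ler01 X1) ?(ltW L0)//.
by rewrite ler_pdivlMr// mulrC le_max lexx orbT.
Qed.

(** In a block of [kappa] consecutive indices every term is at most [X^kappa]
times the first one, so the multiples of [kappa] carry at least the fraction
[1 / (kappa X^kappa)] of the exponential series. *)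
Lemma expR_block_partial_le (R : realType) (kappa N : nat) (X : R) : 1 <= X ->
  \sum_(0 <= n < kappa * N) X ^+ n / n`!%:R <=
  kappa%:R * X ^+ kappa * \sum_(0 <= j < N) X ^+ (kappa * j) / (kappa * j)`!%:R.
Proof.
move=> X1.
have X0 : 0 <= X by exact: le_trans X1.
elim: N => [|N IH]; first by rewrite muln0 !big_geq// mulr0.
rewrite [in leRHS]big_nat_recr//= mulrDr mulnS addnC.
rewrite (big_cat_nat _ (leq_addr kappa (kappa * N)))//= lerD//.
rewrite -mulrA mulr_natl -[X in _ *+ X](addKn (kappa * N) kappa).
rewrite -sumr_const_nat.
rewrite !big_nat; apply: ler_sum => n /andP[n1 n2].
apply: (@le_trans _ _ (X ^+ n / (kappa * N)`!%:R)).
  rewrite ler_wpM2l ?exprn_ge0// lef_pV2 ?posrE ?ltr0n ?fact_gt0//.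
  by rewrite ler_nat leq_fact.
rewrite mulrA ler_wpM2r ?invr_ge0// -exprD.
by apply: ler_weXn2l => //; rewrite addnC ltnW.
Qed.

Lemma multiples_partial_le (R : realType) (g : nat -> R) (kappa N : nat) :
  (0 < kappa)%N -> (forall n, 0 <= g n) ->
  \sum_(0 <= k < N) g (kappa * k)%N <= \sum_(0 <= n < kappa * N) g n.
Proof.
move=> k0 g0; elim: N => [|N IH]; first by rewrite muln0 !big_geq.
rewrite big_nat_recr//= mulnS addnC.
rewrite (big_cat_nat _ (leq_addr kappa (kappa * N)))//= lerD//.
rewrite big_ltn; last by rewrite -{1}[(kappa * N)%N]addn0 ltn_add2l.
by rewrite lerDl sumr_ge0.
Qed.

(** The bound [S] on the partial sums stands for the sum of the series. The
block comparison reduces the exponential to indices [kappa j]; those with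
[j >= K + B] are matched with the coefficients through [j = k + B], and the
finitely many others give the polynomial term. *)
Lemma expR_le_pseries (R : realType) (h : nat -> R) (A L : R)
    (kappa B K : nat) (X S : R) :
  (0 < kappa)%N -> 0 < A -> 0 < L -> (forall n, 0 <= h n) ->
  (forall k, (K <= k)%N ->
    A * L ^+ (kappa * k) / (kappa * (k + B))`!%:R <= h (kappa * k)%N) ->
  1 <= X -> (forall N, \sum_(0 <= n < N) h n * (X / L) ^+ n <= S) ->
  expR X <= (kappa * (K + B))%:R * X ^+ (kappa + kappa * (K + B))
            + kappa%:R / A * X ^+ (kappa + kappa * (K + B)) * S.
Proof.
move=> k0 A0 L0 h0 hL X1 hS.
have X0 : 0 <= X by exact: le_trans X1.
have S0 : 0 <= S by have := hS 0%N; rewrite big_geq.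
apply: expR_le_partial => N.
have t0 n : 0 <= X ^+ n / n`!%:R by rewrite divr_ge0 ?exprn_ge0.
apply: (@le_trans _ _ (\sum_(0 <= n < kappa * (K + B + N)) X ^+ n / n`!%:R)).
  rewrite [leRHS](@big_cat_nat _ _ _ N)//=; last first.
    by rewrite (leq_trans (leq_addl (K + B) N))// leq_pmull.
  by rewrite lerDl sumr_ge0.
apply: le_trans (expR_block_partial_le _ _ X1) _.
have -> : (kappa * (K + B))%:R * X ^+ (kappa + kappa * (K + B))
    + kappa%:R / A * X ^+ (kappa + kappa * (K + B)) * S
    = kappa%:R * X ^+ kappa * ((K + B)%:R * X ^+ (kappa * (K + B)) +
        X ^+ (kappa * (K + B)) / A * S).
  by rewrite exprD natrM; field; rewrite gt_eqF.
rewrite ler_wpM2l ?mulr_ge0 ?exprn_ge0//.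
rewrite (big_cat_nat _ (leq_addr N (K + B)))//= lerD//.
  rewrite mulr_natl -[X in _ *+ X]subn0 -sumr_const_nat.
  rewrite !big_nat; apply: ler_sum => n /andP[_ nD].
  apply: (@le_trans _ _ (X ^+ (kappa * n))).
    rewrite ler_pdivrMr ?ltr0n ?fact_gt0// ler_peMr ?exprn_ge0//.
    by rewrite ler1n fact_gt0.
  by apply: ler_weXn2l => //; rewrite leq_mul2l (ltnW nD) orbT.
apply: (@le_trans _ _ (X ^+ (kappa * B) / A * S)); last first.
  rewrite !ler_wpM2r ?invr_ge0 ?(ltW A0)//.
  by apply: ler_weXn2l => //; rewrite leq_mul2l leq_addl orbT.
rewrite big_addn.
have -> : (K + B + N - B = K + N)%N by lia.
apply: (@le_trans _ _ (X ^+ (kappa * B) / A *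
   \sum_(K <= k < K + N) h (kappa * k)%N * (X / L) ^+ (kappa * k))).
  rewrite mulr_sumr !big_nat; apply: ler_sum => k /andP[Kk _].
  have xk0 : 0 <= X ^+ (kappa * B) / A * (X / L) ^+ (kappa * k).
    by rewrite mulr_ge0// ?exprn_ge0 ?divr_ge0 ?exprn_ge0 ?(ltW A0) ?(ltW L0).
  rewrite mulrCA; apply: le_trans (ler_wpM2r xk0 (hL k Kk)).
  rewrite mulnDr exprD expr_div_n le_eqVlt; apply/orP; left; apply/eqP.
  by field; rewrite pnatr_eq0 -lt0n fact_gt0/= expf_neq0 ?gt_eqF.
rewrite ler_wpM2l ?divr_ge0 ?exprn_ge0 ?(ltW A0)//.
have g0 n : 0 <= h n * (X / L) ^+ n.
  by rewrite mulr_ge0// exprn_ge0// divr_ge0// ltW.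
apply: le_trans (hS (kappa * (K + N))%N).
apply: le_trans (multiples_partial_le (K + N) k0 g0).
by rewrite [leRHS](big_cat_nat _ (leq_addr N K))//= lerDr sumr_ge0.
Qed.

(** * Exponential tilting *)

Lemma expR_le_quadratic (R : realType) (d : R) : d <= 2^-1 ->
  expR d <= 1 + d + 2 * d ^+ 2.
Proof.
move=> d2.
have h := expR_ge1Dx (- d).
have d1 : 0 < 1 - d by lra.
have -> : expR d = (expR (- d))^-1 by rewrite expRN invrK.
rewrite -div1r ler_pdivrMr ?expR_gt0//.
apply: (@le_trans _ _ ((1 + d + 2 * d ^+ 2) * (1 - d))).
  have : 0 <= d ^+ 2 * (1 - 2 * d) by rewrite mulr_ge0 ?sqr_ge0//; lra.
  have -> : (1 + d + 2 * d ^+ 2) * (1 - d) = 1 + d ^+ 2 * (1 - 2 * d) by ring.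
  lra.
by rewrite ler_wpM2l//; nra.
Qed.

(** The weight [exp (E - d n)] is at least 1 on the summands that are kept. *)
Lemma tilted_partial_le (R : realType) (h : nat -> R) (x d E : R) (m N : nat) :
  absolutely_monotonic h -> 0 < x ->
  (forall n, (m <= n < N)%N -> d * n%:R <= E) ->
  \sum_(m <= n < N) h n * x ^+ n <= expR E * pseries_sum h (x * expR (- d)).
Proof.
move=> hm x0 dE.
have y0 : 0 < x * expR (- d) by rewrite mulr_gt0 ?expR_gt0.
have t0 n : 0 <= h n * (x * expR (- d)) ^+ n.
  by rewrite mulr_ge0 ?exprn_ge0 ?(ltW y0)//; case: hm.
apply: (@le_trans _ _ (expR E * \sum_(m <= n < N) h n * (x * expR (- d)) ^+ n)).
  rewrite mulr_sumr !big_nat; apply: ler_sum => n mnN.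
  rewrite mulrCA ler_wpM2l//; first by case: hm.
  rewrite exprMn mulrCA ler_peMr ?exprn_ge0 ?(ltW x0)//.
  rewrite -expRM_natl -expRD -[leLHS]expR0 ler_expR.
  by rewrite mulrN subr_ge0 mulrC dE.
rewrite ler_wpM2l ?expR_ge0//.
have [mN|Nm] := leqP m N; last first.
  rewrite big_geq ?(ltnW Nm)//.
  by have := absolutely_monotonic_partial_le 0 hm y0; rewrite big_geq.
apply: le_trans (absolutely_monotonic_partial_le N hm y0).
by rewrite [leRHS](big_cat_nat (leq0n m) mN)/= lerDr sumr_ge0.
Qed.

Lemma powR_window (R : realType) (X nu : R) : 0 < X ->
  X `^ (1 - 2 * nu) = X `^ (- nu) * X `^ (- nu) * X.
Proof.
move=> X0; rewrite -[Y in _ * _ * Y](powRr1 (ltW X0)).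
rewrite -!powRD ?(gt_eqF X0) ?implybT//.
by congr (_ `^ _); lra.
Qed.

Section concentration.
Context (R : realType) (h : nat -> R) (L A1 A2 x0 : R) (D : nat).
Hypothesis h_am : absolutely_monotonic h.
Hypothesis L_gt0 : 0 < L.
Hypothesis A1_gt0 : 0 < A1.
Hypothesis A2_gt0 : 0 < A2.
Hypothesis h_lower : forall x, x0 <= x ->
  A1 * expR (L * x) <= x ^+ D * pseries_sum h x.
Hypothesis h_upper : forall x, x0 <= x ->
  pseries_sum h x <= A2 * x ^+ D * expR (L * x).

Let pseries_sum_gt0 x : 0 < x -> x0 <= x -> 0 < pseries_sum h x.
Proof.
move=> xp xx; rewrite -(pmulr_rgt0 _ (exprn_gt0 D xp)).
by apply: lt_le_trans (h_lower xx); rewrite mulr_gt0 ?expR_gt0.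
Qed.

(** Here [exp (- d) <= 1 - d + 2 d^2] and [1/2 <= exp (- d) <= 2], so the
point [x exp (- d)] stays in the range of the two-sided estimate. *)
Lemma tilted_quotient (x d E : R) : 0 < x -> 2 * x0 <= x -> `|d| <= 2^-1 ->
  (pseries_sum h x)^-1 * (expR E * pseries_sum h (x * expR (- d))) <=
  A2 / A1 * 2 ^+ D * x ^+ (D + D)
  * expR (E - d * (L * x) + 2 * d ^+ 2 * (L * x)).
Proof.
move=> xp xx; rewrite ler_norml => /andP[d1 d2].
have e1 : expR (- d) <= 1 - d + 2 * d ^+ 2.
  by have := @expR_le_quadratic R (- d) ltac:(lra); rewrite sqrrN.
have e2 : 2^-1 <= expR (- d) by have := expR_ge1Dx (- d); lra.
have e3 : expR (- d) <= 2 by nra.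
have xx1 : x0 <= x.
  have [p|p] := lerP x0 0; first by apply: le_trans p (ltW xp).
  by lra.
have xx2 : x0 <= x * expR (- d).
  by apply: (@le_trans _ _ (x * 2^-1)); [lra|rewrite ler_pM2l].
have S0 := pseries_sum_gt0 xp xx1.
rewrite mulrC ler_pdivrMr//.
apply: (@le_trans _ _ (expR E *
    (A2 * (x * 2) ^+ D * expR (L * x * (1 - d + 2 * d ^+ 2))))).
  rewrite ler_wpM2l ?expR_ge0//.
  apply: le_trans (h_upper xx2) _.
  rewrite ler_pM ?mulr_ge0 ?exprn_ge0 ?mulr_ge0 ?expR_ge0//;
    rewrite ?(ltW A2_gt0) ?(ltW xp)//.
    rewrite ler_pM2l//; apply: lerXn2r;
      rewrite ?nnegrE ?mulr_ge0 ?expR_ge0 ?(ltW xp)//.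
    by rewrite ler_pM2l.
  by rewrite ler_expR mulrA ler_wpM2l// mulr_ge0 ?(ltW L_gt0) ?(ltW xp).
have -> : expR E * (A2 * (x * 2) ^+ D * expR (L * x * (1 - d + 2 * d ^+ 2))) =
  A2 / A1 * 2 ^+ D * x ^+ D * expR (E - d * (L * x) + 2 * d ^+ 2 * (L * x))
  * (A1 * expR (L * x)).
  have -> : L * x * (1 - d + 2 * d ^+ 2) =
    - E + (E - d * (L * x) + 2 * d ^+ 2 * (L * x)) + L * x by ring.
  rewrite !expRD expRN exprMn; field.
  by rewrite expR_eq0 gt_eqF.
have -> : forall a b : R, a * x ^+ (D + D) * b * pseries_sum h x =
    a * x ^+ D * b * (x ^+ D * pseries_sum h x).
  by move=> a b; rewrite exprD; ring.
rewrite ler_wpM2l ?h_lower// ?mulr_ge0 ?exprn_ge0 ?expR_ge0 ?invr_ge0//;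
  rewrite ?(ltW xp)//.
  exact: ltW.
exact: ltW.
Qed.

(** Both tails in one statement: for the optimal size of [d] the exponent
[E - d X + 2 d^2 X] is at most [1 - X^(1 - 2 nu) / 8], and the surplus
[exp (- X^(1 - 2 nu) / 16)] beats the power of [x]. *)
Lemma tail_estimate (nu : R) : 0 < nu < 2^-1 ->
  exists K : R, 0 < K /\ \forall x \near +oo, forall d E S : R,
    `|d| = (L * x) `^ (- nu) / 4 ->
    E - d * (L * x) <= 1 - (L * x) `^ (1 - 2 * nu) / 4 ->
    0 <= S -> S <= expR E * pseries_sum h (x * expR (- d)) ->
    `|(pseries_sum h x)^-1 * S| <=
      K * `|expR (- (L `^ (1 - 2 * nu) / 16) * x `^ (1 - 2 * nu))|.
Proof.
move=> /andP[nu0 nu2].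
have b0 : 0 < 1 - 2 * nu by lra.
set b := 1 - 2 * nu in b0 *.
(* With this al, the number (L x)^b / 16 is al * x^b. *)
pose al := L `^ b / 16.
have al0 : 0 < al by rewrite divr_gt0 ?powR_gt0.
have z0 : 0 <= (D + D)%:R / b by rewrite divr_ge0// ltW.
have [K K0 hK] := powR_le_expR z0 al0.
pose K1 := A2 / A1 * 2 ^+ D * K * expR 1.
have AD0 : 0 < A2 / A1 * 2 ^+ D by rewrite mulr_gt0 ?divr_gt0 ?exprn_gt0.
exists K1; split; first by rewrite !mulr_gt0 ?invr_gt0 ?expR_gt0.
near=> x => d E S dE hE S0 hS.
have xp : 0 < x by near: x; apply: nbhs_pinfty_gt; exact: num_real.
have xx : 2 * x0 <= x by near: x; apply: nbhs_pinfty_ge; exact: num_real.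
have xx1 : x0 <= x.
  have [p|p] := lerP x0 0; first by apply: le_trans p (ltW xp).
  by lra.
have Lx1 : 1 <= L * x.
  by rewrite -ler_pdivrMl// mulr1; near: x;
    apply: nbhs_pinfty_ge; exact: num_real.
have Lx0 : 0 < L * x by lra.
set P := (L * x) `^ (- nu) in dE.
have P1 : P <= 1.
  by rewrite -[leRHS](powRr0 (L * x)) /P ler_powR//; lra.
have P0 : 0 < P by rewrite powR_gt0.
have W0 : (L * x) `^ b = P * P * (L * x) by exact: powR_window.
have d2 : d ^+ 2 = P * P / 16.
  by rewrite -real_normK ?num_real// dE; field.
have dle : `|d| <= 2^-1 by rewrite dE; lra.
have I0 := pseries_sum_gt0 xp xx1.
rewrite ger0_norm; last by rewrite mulr_ge0// invr_ge0 ltW.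
rewrite ger0_norm ?expR_ge0//.
apply: (le_trans (ler_wpM2l _ hS)); first by rewrite invr_ge0 ltW.
apply: le_trans (tilted_quotient E xp xx dle) _.
have WE : (L * x) `^ b = 16 * (al * x `^ b).
  by rewrite powRM ?(ltW L_gt0) ?(ltW xp)// /al; field.
apply: (@le_trans _ _ (A2 / A1 * 2 ^+ D * (K * expR (al * x `^ b)) *
    expR (1 - 2 * (al * x `^ b)))).
  rewrite ler_pM ?mulr_ge0 ?exprn_ge0 ?expR_ge0 ?invr_ge0 ?(ltW xp)//;
    rewrite ?(ltW A1_gt0) ?(ltW A2_gt0)//.
    rewrite ler_pM2l//.
    have := hK (x `^ b) (powR_ge0 _ _).
    rewrite -powRrM mulrC divfK ?gt_eqF// powR_mulrn ?(ltW xp)//.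
  rewrite ler_expR.
  have : 2 * d ^+ 2 * (L * x) = (L * x) `^ b / 8 by rewrite W0 d2; field.
  move: hE; rewrite WE; set w := al * _; lra.
rewrite le_eqVlt; apply/orP; left; apply/eqP.
have -> : 1 - 2 * (al * x `^ b) = 1 + (- al * x `^ b + - (al * x `^ b)) by ring.
rewrite !expRD [expR (- (al * _))]expRN /K1; field.
by rewrite expR_eq0 gt_eqF.
Unshelve. all: by end_near. Qed.

(** A power series with [log I(x) = L x + O(log x)] concentrates near
[n = L x]. *)
Lemma concentration (nu : R) : 0 < nu < 2^-1 ->
  exists al : R, 0 < al /\
    concentrates_exponentially h (L *: 'X) (L `^ (- nu)) nu al (1 - 2 * nu).
Proof.
move=> nu01; have /andP[nu0 nu2] := nu01.
have [K [K0 hK]] := tail_estimate nu01.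
exists (L `^ (1 - 2 * nu) / 16); split; first by rewrite divr_gt0 ?powR_gt0.
have h0 n : 0 <= h n by case: h_am.
split.
- split=> //.
  pose x := Num.max 1 x0.
  have x1 : 1 <= x by rewrite le_max lexx.
  have : 0 < pseries_sum h x.
    by apply: pseries_sum_gt0; [lra|rewrite le_max lexx orbT].
  apply: contraPP => /forallNP hz.
  rewrite /pseries_sum (_ : pseries h x = fun=> 0) ?lim_cst ?ltxx//.
  apply/funext => N; rewrite /pseries /series/= big1// => n _.
  by have /contrapT -> := hz n; rewrite mul0r.
- by rewrite lead_coefZ lead_coefX mulr1.
- by split; rewrite ?powR_gt0 ?divr_gt0 ?powR_gt0//; lra.
- apply/eqO_exP; exists K => //; near=> x.
  have xp : 0 < x by near: x; apply: nbhs_pinfty_gt; exact: num_real.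
  have Lx0 : 0 < L * x by rewrite mulr_gt0.
  set P := (L * x) `^ (- nu).
  have P0 : 0 < P by rewrite powR_gt0.
  have W0 : (L * x) `^ (1 - 2 * nu) = P * P * (L * x) by exact: powR_window.
  apply: (near hK x _ (P / 4) (P / 4 * (L * x * (1 - P)))) => //.
  + by rewrite ger0_norm// divr_ge0 ?ltW.
  + by rewrite W0; lra.
  + by rewrite /lower_sum sumr_ge0// => n _; rewrite mulr_ge0// exprn_ge0// ltW.
  rewrite /lower_sum; apply: tilted_partial_le => // n /andP[_ nm].
  rewrite ler_pM2l ?divr_gt0//.
  have : n_minus (L *: 'X) (L `^ (- nu)) nu x = Num.floor (L * x * (1 - P)).
    by rewrite /n_minus hornerZ hornerX -powRM// ltW.
  move=> nE; rewrite nE in nm.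
  have : (n%:Z <= Num.floor (L * x * (1 - P)))%R by lia.
  by rewrite -(ler_int R) => /le_trans; apply; exact: floor_le_tmp.
- apply/eqO_exP; exists K => //; near=> x.
  have xp : 0 < x by near: x; apply: nbhs_pinfty_gt; exact: num_real.
  have Lx1 : 1 <= L * x.
    by rewrite -ler_pdivrMl// mulr1; near: x;
    apply: nbhs_pinfty_ge; exact: num_real.
  have Lx0 : 0 < L * x by rewrite mulr_gt0.
  set P := (L * x) `^ (- nu).
  have P0 : 0 < P by rewrite powR_gt0.
  have P1 : P <= 1.
    by rewrite -[leRHS](powRr0 (L * x)) /P ler_powR//; lra.
  have W0 : (L * x) `^ (1 - 2 * nu) = P * P * (L * x) by exact: powR_window.
  have nE : n_plus (L *: 'X) (L `^ (- nu)) nu x = Num.floor (L * x * (1 + P)).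
    by rewrite /n_plus hornerZ hornerX -powRM// ltW.
  (* Rounding down costs at most 1: an index n in the sum satisfies
     n > L x (1 + P) - 1. *)
  pose E := - (P / 4) * (L * x * (1 + P) - 1).
  pose m := absz (Num.max 0 (n_plus (L *: 'X) (L `^ (- nu)) nu x)).
  have hS N : \sum_(m <= n < N) h n * x ^+ n <=
      expR E * pseries_sum h (x * expR (- - (P / 4))).
    apply: tilted_partial_le => // n /andP[nm _].
    rewrite /E ler_nM2l; last by rewrite oppr_lt0 divr_gt0.
    rewrite /m nE in nm.
    have : (Num.floor (L * x * (1 + P)) <= n%:Z)%R by lia.
    rewrite -(ler_int R) => nm'.
    have := floorD1_gt (L * x * (1 + P)); rewrite intrD1 => ?; lra.
  have nd : {homo (fun N => \sum_(m <= n < N) h n * x ^+ n) :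
      N1 N2 / (N1 <= N2)%N >-> N1 <= N2}.
    by apply: nondecreasing_series => n _ _; rewrite mulr_ge0// exprn_ge0// ltW.
  have cv : cvgn (fun N => \sum_(m <= n < N) h n * x ^+ n).
    apply: nondecreasing_is_cvgn => //.
    by exists (expR E * pseries_sum h (x * expR (- - (P / 4)))) => _ [N _ <-].
  apply: (near hK x _ (- (P / 4)) E) => //.
  + by rewrite normrN ger0_norm// divr_ge0 ?ltW.
  + by rewrite W0 /E; lra.
  + apply: limr_ge => //; near=> N.
    by rewrite sumr_ge0// => n _; rewrite mulr_ge0// exprn_ge0// ltW.
  + by apply: limr_le => //; near=> N.
Unshelve. all: by end_near. Qed.

End concentration.

(** * From coefficient quotients to concentration *)

(** Enlarging the constant by the sum of the first [N] quotients covers the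
remaining indices. *)
Lemma factorial_bound_everywhere (R : realType) (h : nat -> R) (A L : R)
    (D N : nat) :
  0 <= A -> 0 < L -> (forall n, 0 <= h n) ->
  (forall n, (N <= n)%N -> h n <= A * L ^+ n / (n - D)`!%:R) ->
  exists2 A' : R, 0 < A' & forall n, h n <= A' * L ^+ n / (n - D)`!%:R.
Proof.
move=> A0 L0 h0 hU.
have f0 n : 0 < L ^+ n / (n - D)`!%:R.
  by rewrite divr_gt0 ?exprn_gt0// ltr0n fact_gt0.
pose t n := h n / (L ^+ n / (n - D)`!%:R).
have t0 n : 0 <= t n by rewrite divr_ge0// ltW.
have s0 : 0 <= \sum_(i < N) t i by rewrite sumr_ge0.
exists (A + 1 + \sum_(i < N) t i); first by lra.
move=> n; have [Nn|nN] := leqP N n.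
  apply: le_trans (hU n Nn) _; rewrite -!mulrA ler_pM2r//; lra.
rewrite -mulrA -ler_pdivrMr// -/(t n).
rewrite (bigD1 (Ordinal nN))//= addrCA lerDl addr_ge0 ?sumr_ge0//; lra.
Qed.

Section ratio_concentration.
Context (R : realType) (h c : nat -> R) (kappa : nat) (L : R).
Hypothesis kappa_gt0 : (0 < kappa)%N.
Hypothesis L_gt0 : 0 < L.
Hypothesis h_mul : forall k, h (kappa * k)%N = c k.
Hypothesis h_ndvd : forall n, ~~ (kappa %| n)%N -> h n = 0.
Hypothesis c_ge0 : forall k, 0 <= c k.
Hypothesis c_gt0 : \forall k \near \oo, 0 < c k.
Hypothesis c_ratio :
  one_plus_O_inv (fun k => c k.+1 / c k * (kappa%:R * k%:R / L) ^+ kappa).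

Lemma coef_ge0 n : 0 <= h n.
Proof.
have [/dvdnP[k ->]|/h_ndvd ->//] := boolP (kappa %| n)%N.
by rewrite mulnC h_mul.
Qed.

(** The two shifts are replaced by their sum, so that a single [B] serves both
bounds. *)
Lemma coef_sandwich : exists (A A' : R) (B K : nat), [/\ 0 < A, 0 < A',
  forall n, h n <= A * L ^+ n / (n - kappa * B)`!%:R &
  forall k, (K <= k)%N ->
    A' * L ^+ (kappa * k) / (kappa * (k + B))`!%:R <= h (kappa * k)%N].
Proof.
pose u k := c k / L ^+ (kappa * k).
have Lk k : 0 < L ^+ (kappa * k) by rewrite exprn_gt0.
have u_gt0 : \forall k \near \oo, 0 < u k.
  by near=> k; rewrite divr_gt0//; near: k.
have [M M0 hM] := c_ratio.
have u_ratio : \forall k \near \oo,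
    `|u k.+1 / u k * (kappa%:R * k%:R) ^+ kappa - 1| <= M / k%:R.
  near=> k.
  have ck : 0 < c k by near: k.
  have -> : u k.+1 / u k * (kappa%:R * k%:R) ^+ kappa =
      c k.+1 / c k * (kappa%:R * k%:R / L) ^+ kappa.
    rewrite /u mulnS exprD expr_div_n; field.
    by rewrite !gt_eqF ?exprn_gt0.
  by near: k.
have [A [B [K [A0 hA]]]] := ratio_upper kappa_gt0 M0 u_gt0 u_ratio.
have [A' [B' [K' [A'0 hA']]]] := ratio_lower kappa_gt0 M0 u_gt0 u_ratio.
have hN n : (kappa * K <= n)%N ->
    h n <= A * L ^+ n / (n - kappa * (B + B'))`!%:R.
  have [/dvdnP[k ->]|/h_ndvd -> _] := boolP (kappa %| n)%N; last first.
    by rewrite !mulr_ge0 ?invr_ge0 ?exprn_ge0 ?(ltW A0) ?(ltW L_gt0).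
  rewrite [(k * _)%N]mulnC leq_pmul2l// => Kk.
  rewrite h_mul -mulrAC -ler_pdivrMr// -/(u k).
  apply: le_trans (hA k Kk) _.
  rewrite ler_wpM2l ?(ltW A0)// lef_pV2 ?posrE ?ltr0n ?fact_gt0// ler_nat.
  by apply: leq_fact; rewrite -mulnBr leq_mul2l; lia.
have [A2 A20 hA2] := factorial_bound_everywhere (ltW A0) L_gt0 coef_ge0 hN.
exists A2, A', (B + B')%N, K'; split=> // k Kk.
rewrite h_mul mulrAC -ler_pdivlMr// -/(u k).
apply: le_trans (hA' k Kk).
rewrite ler_wpM2l ?(ltW A'0)// lef_pV2 ?posrE ?ltr0n ?fact_gt0// ler_nat.
by apply: leq_fact; rewrite leq_mul2l; lia.
Unshelve. all: by end_near. Qed.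

Lemma ratio_cvgn (x : R) : cvgn (pseries h x).
Proof.
have [A [_ [B [_ [A0 _ hU _]]]]] := coef_sandwich.
exact: cvgn_pseries_factorial (ltW A0) L_gt0 coef_ge0 hU.
Qed.

Lemma ratio_absolutely_monotonic : absolutely_monotonic h.
Proof. by split; [exact: coef_ge0|move=> x _; exact: ratio_cvgn]. Qed.

(** The polynomial term of [expR_le_pseries] is at most half of the
exponential once [X] is large; all powers of [X] are raised to the common
exponent [E + D]. *)
Lemma ratio_concentrates (nu : R) : 0 < nu < 2^-1 ->
  exists al : R, 0 < al /\
    concentrates_exponentially h (L *: 'X) (L `^ (- nu)) nu al (1 - 2 * nu).
Proof.
have [A [A' [B [K [A0 A'0 hU hL]]]]] := coef_sandwich.
have hm := ratio_absolutely_monotonic.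
pose D := (kappa * B)%N; pose E := (kappa + kappa * (K + B))%N.
pose a1 : R := (kappa * (K + B))%:R; pose a2 := kappa%:R / A'.
have k0 : 0 < kappa%:R :> R by rewrite ltr0n.
have a20 : 0 < a2 by rewrite divr_gt0.
have [c1 c10 hc1] := @powR_le_expR R E.+1%:R 1 (ler0n _ _) ltr01.
have LED0 : 0 < L ^+ (E + D) by rewrite exprn_gt0.
pose X0 := Num.max 1 (2 * a1 * c1).
apply: (@concentration R h L (2 * a2 * L ^+ (E + D))^-1
   (A * D.+1%:R * L ^+ (E + D)) (X0 / L) (E + D)) => //.
- by rewrite invr_gt0 mulr_gt0// mulr_gt0.
- by rewrite mulr_gt0// mulr_gt0.
- move=> x; rewrite ler_pdivrMr// mulrC ge_max => /andP[X1 X2].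
  have x0 : 0 < x by rewrite -(pmulr_rgt0 _ L_gt0); lra.
  have I0 : 0 <= pseries_sum h x.
    by have := absolutely_monotonic_partial_le 0 hm x0; rewrite big_geq.
  have LxL : L * x / L = x by field; rewrite gt_eqF.
  have hS N : \sum_(0 <= n < N) h n * (L * x / L) ^+ n <= pseries_sum h x.
    by rewrite LxL; exact: absolutely_monotonic_partial_le.
  have := expR_le_pseries kappa_gt0 A'0 L_gt0 coef_ge0 hL X1 hS.
  rewrite -/E -/a1 -/a2.
  have Lx0 : 0 < L * x by lra.
  have : a1 * (L * x) ^+ E <= 2^-1 * expR (L * x).
    have := hc1 (L * x) (ltW Lx0).
    rewrite mul1r powR_mulrn ?(ltW Lx0)// exprS => h1.
    rewrite -(ler_pM2l Lx0) mulrCA.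
    apply: (le_trans (ler_wpM2l _ h1)); first by rewrite ler0n.
    rewrite !mulrA ler_pM2r ?expR_gt0//; lra.
  have : a2 * (L * x) ^+ E * pseries_sum h x <=
         a2 * (L * x) ^+ (E + D) * pseries_sum h x.
    by rewrite ler_wpM2r// ler_pM2l// ler_weXn2l// leq_addr.
  move=> h1 h2 h3.
  rewrite mulrC ler_pdivrMr; last by rewrite mulr_gt0// mulr_gt0.
  have -> : x ^+ (E + D) * pseries_sum h x * (2 * a2 * L ^+ (E + D)) =
    2 * (a2 * (L * x) ^+ (E + D) * pseries_sum h x) by rewrite exprMn; ring.
  move: h1 h2 h3; set p1 := a2 * _ * _; set p2 := a2 * _ * _; set p3 := a1 * _.
  lra.
- move=> x; rewrite ler_pdivrMr// mulrC ge_max => /andP[X1 _].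
  have LxL : L * x / L = x by field; rewrite gt_eqF.
  have Lx0 : 0 < L * x by lra.
  apply: limr_le; first exact: ratio_cvgn.
  near=> N; have := pseries_partial_upper N (ltW A0) L_gt0 hU X1.
  rewrite LxL => /le_trans; apply.
  rewrite ler_pM2r ?expR_gt0// -[leRHS]mulrA -exprMn ler_pM2l ?mulr_gt0//.
  by rewrite ler_weXn2l// leq_addl.
Unshelve. all: by end_near. Qed.

End ratio_concentration.

(** Positivity is claimed for large [k] only: then every argument is at least
1, where [Gamma_gt0] applies. *)
Lemma prod_Gamma_step (R : realType) (n : nat) (al a : 'I_n -> R) :
  (forall i, 0 < al i) -> (forall i, 0 < a i) ->
  exists2 g : nat -> R, one_plus_O_inv g & \forall k \near \oo,
    0 < \prod_(i < n) Gamma (al i * k%:R + a i) /\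
    \prod_(i < n) Gamma (al i * k.+1%:R + a i) =
    g k * \prod_(i < n) al i `^ al i * k%:R `^ (\sum_(i < n) al i)
    * \prod_(i < n) Gamma (al i * k%:R + a i).
Proof.
move=> al0 a0.
pose gi (i : 'I_n) (k : nat) :=
  Gamma (al i * k.+1%:R + a i) / Gamma (al i * k%:R + a i)
  / (al i * k%:R) `^ al i.
exists (fun k => \prod_(i < n) gi i k).
  by apply: one_plus_O_inv_prod => i; exact: Gamma_step_asymp.
have G0 : \forall k \near \oo, forall i, 0 < Gamma (al i * k%:R + a i).
  apply: filter_forall => i; near=> k.
  apply: Gamma_gt0.
  apply: (@le_trans _ _ (al i * k%:R)); last by rewrite lerDl ltW.
  by rewrite -ler_pdivrMl// mulr1; near: k; exact: nbhs_infty_ger.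
near=> k.
have Gk : forall i, 0 < Gamma (al i * k%:R + a i) by near: k.
have k0 : (0 : R) < k%:R by rewrite ltr0n; near: k; exact: nbhs_infty_gt.
split; first by rewrite prodr_gt0.
have -> : k%:R `^ (\sum_(i < n) al i) = \prod_(i < n) k%:R `^ al i.
  elim/big_rec2: _ => [|i y1 y2 _ <-]; first by rewrite powRr0.
  by rewrite powRD// (gt_eqF k0) implybT.
rewrite -!big_split/=; apply: eq_bigr => i _.
rewrite /gi powRM ?(ltW k0) ?(ltW (al0 i))//; field.
by rewrite !gt_eqF ?powR_gt0.
Unshelve. all: by end_near. Qed.

(** * The hypergeometric weights *)

(** The exponents of [k] in numerator and denominator differ by [kappa], and
the constant of [L^kappa = kappa^kappa * C * T^kappa] cancels the product of
the [alpha_r^alpha_r] and [beta_s^(- beta_s)]. *)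
Lemma gamma_weight_ratio (R : realType) (p q : nat) (alpha a : 'I_p -> R)
    (beta b : 'I_q -> R) (omega : nat -> R) (T C : R) (kappa : nat) :
  (forall r, 0 < alpha r) -> (forall r, 0 < a r) ->
  (forall s, 0 < beta s) -> (forall s, 0 < b s) -> 0 < T -> (0 < kappa)%N ->
  kappa%:R = \sum_(s < q) beta s - \sum_(r < p) alpha r ->
  C = (\prod_(r < p) alpha r `^ alpha r) * \prod_(s < q) beta s `^ (- beta s) ->
  (forall k, 0 < omega k) -> one_plus_O_inv (fun k => omega k.+1 / omega k) ->
  let c k := gamma_weight alpha a beta b omega k * T ^+ (kappa * k) in
  (\forall k \near \oo, 0 < c k) /\
  one_plus_O_inv (fun k => c k.+1 / c k *
    (kappa%:R * k%:R / (kappa%:R * C `^ kappa%:R^-1 * T)) ^+ kappa).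
Proof.
move=> al0 a0 be0 b0 T0 kp0 kE CE om0 omr c.
have [gA gAO hA] := prod_Gamma_step al0 a0.
have [gB gBO hB] := prod_Gamma_step be0 b0.
have cpos : \forall k \near \oo, 0 < c k.
  near=> k; rewrite /c /gamma_weight mulr_gt0 ?exprn_gt0// mulr_gt0//.
  by rewrite divr_gt0//; [have [] := near hA k|have [] := near hB k].
split=> //.
have CA0 : 0 < \prod_(r < p) alpha r `^ alpha r.
  by rewrite prodr_gt0// => r _; rewrite powR_gt0.
have CB0 : 0 < \prod_(s < q) beta s `^ beta s.
  by rewrite prodr_gt0// => r _; rewrite powR_gt0.
have CE' : C =
    (\prod_(r < p) alpha r `^ alpha r) / \prod_(s < q) beta s `^ beta s.
  by rewrite CE -prodfV; congr (_ * _); apply: eq_bigr => s _; rewrite powRN.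
have C0 : 0 < C by rewrite CE' divr_gt0.
have kr0 : 0 < kappa%:R :> R by rewrite ltr0n.
have CK : (C `^ kappa%:R^-1) ^+ kappa = C.
  by rewrite -powR_mulrn ?powR_ge0// -powRrM mulVf ?gt_eqF// powRr1// ltW.
apply: one_plus_O_inv_ext
  (one_plus_O_invM omr (one_plus_O_invM gAO (one_plus_O_invV gBO))).
have pBS : \forall k \near \oo,
    0 < \prod_(i < q) Gamma (beta i * k.+1%:R + b i).
  by case: hB => N _ hN; exists N => // n /= Nn; case: (hN n.+1 (leqW Nn)).
near=> k.
have [pA eA] : 0 < \prod_(i < p) Gamma (alpha i * k%:R + a i) /\
    \prod_(i < p) Gamma (alpha i * k.+1%:R + a i) =
    gA k * \prod_(i < p) alpha i `^ alpha i * k%:R `^ (\sum_(i < p) alpha i)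
    * \prod_(i < p) Gamma (alpha i * k%:R + a i) by near: k.
have [pB eB] : 0 < \prod_(i < q) Gamma (beta i * k%:R + b i) /\
    \prod_(i < q) Gamma (beta i * k.+1%:R + b i) =
    gB k * \prod_(i < q) beta i `^ beta i * k%:R `^ (\sum_(i < q) beta i)
    * \prod_(i < q) Gamma (beta i * k%:R + b i) by near: k.
have ck1 : 0 < \prod_(i < q) Gamma (beta i * k.+1%:R + b i) by near: k.
have k0 : (0 : R) < k%:R by rewrite ltr0n; near: k; exact: nbhs_infty_gt.
rewrite /c /gamma_weight eA eB.
have -> : \sum_(s < q) beta s = kappa%:R + \sum_(r < p) alpha r.
  by rewrite kE subrK.
rewrite powRD ?(gt_eqF k0) ?implybT// powR_mulrn ?(ltW k0)//.
rewrite mulnS exprD !exprMn exprVn !exprMn CK CE'.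
have gB0 : gB k != 0.
  by apply: contraPneq ck1 => gB0; rewrite eB gB0 !mul0r ltxx.
have ks0 : k%:R `^ (\sum_(r < p) alpha r) != 0 by rewrite gt_eqF ?powR_gt0.
have om := gt_eqF (om0 k).
field.
by rewrite gB0 ks0 om !gt_eqF ?exprn_gt0.
Unshelve. all: by end_near. Qed.

Lemma H_coef_mul (R : realType) (p q : nat) (alpha a : 'I_p -> R)
    (beta b : 'I_q -> R) (omega : nat -> R) (T : R) (kappa k : nat) :
  (0 < kappa)%N ->
  H_coef alpha a beta b omega T kappa (kappa * k) =
  gamma_weight alpha a beta b omega k * T ^+ (kappa * k).
Proof.
move=> k0; rewrite /H_coef (eq_bigl (pred1 k)); last first.
  by move=> j /=; rewrite eqn_pmul2l.
rewrite -big_filter filter_pred1_uniq ?iota_uniq ?big_seq1//.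
by rewrite mem_index_iota ltnS leq_pmull.
Qed.

Lemma H_coef_ndvd (R : realType) (p q : nat) (alpha a : 'I_p -> R)
    (beta b : 'I_q -> R) (omega : nat -> R) (T : R) (kappa n : nat) :
  ~~ (kappa %| n)%N -> H_coef alpha a beta b omega T kappa n = 0.
Proof.
move=> kn; rewrite /H_coef big1// => k /eqP kE.
by rewrite -kE dvdn_mulr in kn.
Qed.

(** Summing over whole blocks of length [kappa] makes the partial sums of [H]
in the index [k] a subsequence of those in the index [n]. *)
Lemma multiples_sumE (R : realType) (g : nat -> R) (kappa N : nat) :
  (0 < kappa)%N -> (forall n, ~~ (kappa %| n)%N -> g n = 0) ->
  \sum_(0 <= n < kappa * N) g n = \sum_(0 <= k < N) g (kappa * k)%N.
Proof.
move=> k0 g0; elim: N => [|N IH]; first by rewrite muln0 !big_geq.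
rewrite [RHS]big_nat_recr//= mulnS addnC -IH.
rewrite (big_cat_nat _ (leq_addr kappa (kappa * N)))//=; congr (_ + _).
rewrite big_ltn; last by rewrite -{1}[(kappa * N)%N]addn0 ltn_add2l.
rewrite big_nat big1 ?addr0// => n /andP[n1 n2]; apply: g0.
apply/negP => /dvdnP[j nE]; move: n1 n2; rewrite nE [(j * _)%N]mulnC.
rewrite ltn_pmul2l// => Nj; rewrite addnC -mulnS ltn_pmul2l// ltnS => jN.
by rewrite ltnNge jN in Nj.
Qed.

Theorem theorem3p5 (R : realType) (p q : nat) (q_gt0 : (0 < q)%N)
    (alpha a : 'I_p -> R) (beta b : 'I_q -> R) (T : R)
    (alpha_gt0 : forall r, 0 < alpha r) (a_gt0 : forall r, 0 < a r)
    (beta_gt0 : forall s, 0 < beta s) (b_gt0 : forall s, 0 < b s)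
    (T_gt0 : 0 < T)
    (kappa : nat) (kappa_gt0 : (0 < kappa)%N)
    (kappaE : kappa%:R = \sum_(s < q) beta s - \sum_(r < p) alpha r)
    (C : R)
    (CE : C = (\prod_(r < p) alpha r `^ alpha r)
              * \prod_(s < q) beta s `^ (- beta s))
    (omega : nat -> R) (omega_gt0 : forall k, 0 < omega k)
    (omega_ratio : (fun k : nat => omega k.+1 / omega k)
       = (fun=> 1) +O_\oo (fun k : nat => k%:R^-1 : R)) :
  (forall x : R,
     H_series alpha a beta b omega T kappa x @ \oo
       --> pseries_sum (H_coef alpha a beta b omega T kappa) x) /\
  absolutely_monotonic (H_coef alpha a beta b omega T kappa) /\
  forall nu : R, 0 < nu < 2^-1 ->
    exists al : R, 0 < al /\
      concentrates_exponentially
        (H_coef alpha a beta b omega T kappa)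
        ((kappa%:R * C `^ (kappa%:R^-1) * T) *: 'X)
        ((kappa%:R * C `^ (kappa%:R^-1) * T) `^ (- nu))
        nu al (1 - 2 * nu).
Proof.
have omr : one_plus_O_inv (fun k => omega k.+1 / omega k).
  move: omega_ratio => /eqaddOP /bigO_exP[M M0 hM].
  exists M; first exact: ltW.
  by apply: filterS hM => k; rewrite normfV normr_nat.
pose c k := gamma_weight alpha a beta b omega k * T ^+ (kappa * k).
have [c_gt0 c_ratio] := gamma_weight_ratio alpha_gt0 a_gt0 beta_gt0 b_gt0
  T_gt0 kappa_gt0 kappaE CE omega_gt0 omr.
have C0 : 0 < C.
  by rewrite CE mulr_gt0// prodr_gt0// => i _; rewrite powR_gt0.
have L0 : 0 < kappa%:R * C `^ kappa%:R^-1 * T.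
  by rewrite !mulr_gt0 ?powR_gt0// ltr0n.
have c_ge0 k : 0 <= c k.
  rewrite /c /gamma_weight mulr_ge0 ?exprn_ge0 ?(ltW T_gt0)//.
  rewrite mulr_ge0 ?(ltW (omega_gt0 k))//.
  by rewrite divr_ge0// prodr_ge0// => i _; exact: Gamma_ge0.
have h_mul k : H_coef alpha a beta b omega T kappa (kappa * k) = c k.
  exact: H_coef_mul.
have h_ndvd := @H_coef_ndvd R p q alpha a beta b omega T kappa.
split; last first.
  split; first exact: (ratio_absolutely_monotonic kappa_gt0 L0 h_mul).
  move=> nu nu01.
  exact: (ratio_concentrates kappa_gt0 L0 h_mul).
move=> x.
have hc := ratio_cvgn kappa_gt0 L0 h_mul h_ndvd c_ge0 c_gt0 c_ratio (x := x).
have := cvg_comp _ _ (@cvg_mulnl kappa kappa_gt0) hc.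
apply: cvg_trans; apply: near_eq_cvg; near=> N.
rewrite /= /H_series /pseries /series/= multiples_sumE//; last first.
  by move=> n /h_ndvd ->; rewrite mul0r.
apply: eq_bigr => k _; rewrite h_mul /c exprMn mulrA.
Unshelve. all: by end_near. Qed.
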